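(* Let $d\ge2$, let $\mathcal{K}$ be a Hilbert space, and let $V_1,\dots,V_d\in\mathcal{B}(\mathcal{K})$ satisfy $\sum_{i=1}^dV_iV_i^*=1$. Then: (1) $\mathcal{K}$ can be embedded into a larger Hilbert space $\mathcal{H}=\mathcal{H}_V$ carrying a representation $S_1,\dots,S_d$ of the Cuntz algebra $\mathcal{O}_d$ such that, if $P\colon\mathcal{H}\to\mathcal{K}$ is the orthogonal projection onto $\mathcal{K}$, then $V_i^*=S_i^*P$ (i.e. $S_i^*\mathcal{K}\subset\mathcal{K}$ and $S_i^*P=PS_i^*P=V_i^*$) for all $i$, and $\mathcal{K}$ is cyclic for the representation. The system $(\mathcal{H},S_1,\dots,S_d,P)$ is unique up to unitary equivalence. (2) If $\boldsymbol{\sigma}\colon\mathcal{B}(\mathcal{K})\to\mathcal{B}(\mathcal{K})$ is defined by $\boldsymbol{\sigma}(A)=\sum_iV_iAV_i^*$, then the commutant $\{S_1,\dots,S_d\}'$ of the representation is isometrically order isomorphic to the fixed point set $\mathcal{B}(\mathcal{K})^{\boldsymbol{\sigma}}=\{A\in\mathcal{B}(\mathcal{K}):\boldsymbol{\sigma}(A)=A\}$ by the map $A'\mapsto PA'P$. (3) More generally, if $W_1,\dots,W_d\in\mathcal{B}(\mathcal{K})$ is another set of operators satisfying $\sum_{i=1}^dW_iW_i^*=1$, and $T_1,\dots,T_d$ on $\mathcal{H}_W\supset\mathcal{K}$ are the corresponding representatives of $s_1,\dots,s_d$ (obtained from $W_1,\dots,W_d$ as in (1)), then there is an isometric linear isomorphism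 between the intertwiners $U\colon\mathcal{H}_V\to\mathcal{H}_W$, i.e. the bounded operators satisfying $US_i=T_iU$ for all $i$, and the operators $V\in\mathcal{B}(\mathcal{K})$ such that $$\sum_{i=1}^dW_iVV_i^*=V,$$ given by the map $U\mapsto V=PUP$.
   Context: $\mathcal{O}_d$ is the universal $C^*$-algebra generated by $s_1,\dots,s_d$ with $s_i^*s_j=\delta_{ij}1$ and $\sum_js_js_j^*=1$; a representation of $\mathcal{O}_d$ is given by operators $S_i$ (images of $s_i$) satisfying these relations. $\{S_1,\dots,S_d\}'$ denotes the commutant of the representation, i.e. of the $C^*$-algebra generated by the $S_i$ (operators commuting with all $S_i$ and $S_i^*$). $\mathcal{K}$ is cyclic if the span of the vectors obtained by applying the represented algebra to $\mathcal{K}$ is dense in $\mathcal{H}$. In $PA'P$ the result is regarded as an operator on $\mathcal{K}$; in $PUP$ the right-hand $P$ is the projection of $\mathcal{H}_V$ onto $\mathcal{K}$ and the left-hand $P$ is the projection of $\mathcal{H}_W$ onto $\mathcal{K}$, so $PUP$ is regarded as an operator on $\mathcal{K}$. Unitary equivalence of systems $(\mathcal{H},S_1,\dots,S_d,P)$ is by unitaries intertwining the representations and acting as the identity on the embedded copy of $\mathcal{K}$. *)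

(* Defs.v *)
From HB Require Import structures.
From mathcomp Require Import all_boot all_order all_algebra.
From mathcomp Require Import sesquilinear complex.
From mathcomp Require Import all_classical all_reals topology normedtype.

Set Implicit Arguments.
Unset Strict Implicit.
Unset Printing Implicit Defensive.

Import Order.TTheory GRing.Theory Num.Theory numFieldNormedType.Exports.

Local Open Scope classical_set_scope.
Local Open Scope complex_scope.
Local Open Scope ring_scope.

(* The inner product is linear in the first variable and antilinear in the
   second. The zero space is allowed, and no separability is assumed. *)
HB.mixin Record isHilbert (R : realType) H of CompleteNormedModule R[i] H := {
  inner : {dot H for (@Num.conj R[i])};
  inner_norm : forall x : H, `|x| ^+ 2 = inner x x
}.

#[short(type="hilbertType")]
HB.structure Definition Hilbert (R : realType) :=
  {H of CompleteNormedModule R[i] H & isHilbert R H}.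

Notation "'[ x , y ]" := (inner x y) : ring_scope.

Section BoundedOperators.
Context (R : realType) (H K : hilbertType R).

Definition bounded_linear : {pred H -> K} :=
  fun f => `[< linear f /\ exists M : R[i], forall x, `|f x| <= M * `|x| >].

Fact bounded_linear_submod_closed : submod_closed bounded_linear.
Proof.
split=> [|a f g].
  rewrite inE; split=> [b u v|]; first by rewrite scaler0 addr0.
  by exists 0 => x; rewrite normr0 mul0r.
rewrite !inE => -[flin [M fM]] [glin [N gN]]; split=> [b u v|].
  rewrite -[LHS]/(a *: f _ + g _) flin glin.
  rewrite -[RHS]/(b *: (a *: f u + g u) + (a *: f v + g v)).
  by rewrite !scalerDr !scalerA (mulrC a b) addrACA.
exists (`|a| * M + N) => x; rewrite mulrDl -mulrA.
rewrite (le_trans (ler_normD _ _)) // lerD // normrZ.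
by rewrite ler_wpM2l.
Qed.

HB.instance Definition _ := GRing.isSubmodClosed.Build R[i] (H -> K)
  bounded_linear bounded_linear_submod_closed.

Record boundedOp := BoundedOp {
  bop_fun :> H -> K;
  bop_funP : bop_fun \in bounded_linear
}.

HB.instance Definition _ := [isSub for bop_fun].
HB.instance Definition _ := [Choice of boundedOp by <:].
HB.instance Definition _ := [SubChoice_isSubLmodule of boundedOp by <:].

Implicit Types A B : boundedOp.

Fact bop_linear A : linear A.
Proof. by have := bop_funP A; rewrite inE => -[]. Qed.

HB.instance Definition _ A :=
  GRing.isLinear.Build R[i] H K _ (bop_fun A) (bop_linear A).

Definition opnorm A : R :=
  sup [set complex.Re `|A x| | x in [set x : H | `|x| <= 1]].

Let normE (V : hilbertType R) (x : V) : (complex.Re `|x|)%:C = `|x|.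
Proof. by rewrite RRe_real // normr_real. Qed.

Let opnorm_ub A :
  has_ubound [set complex.Re `|A x| | x in [set x : H | `|x| <= 1]].
Proof.
have := bop_funP A; rewrite inE => -[_ [M AM]].
exists (complex.Re `|M|) => _ [x /= x1 <-].
rewrite -lecR normE -[leRHS]/`|M|.
apply: (@le_trans _ _ (`|M| * `|x|)); last by rewrite ler_piMr.
apply: le_trans (AM x) _; have [->|x0] := eqVneq x 0.
  by rewrite normr0 !mulr0.
have Mge0 : 0 <= M.
  by rewrite -(@pmulr_lge0 _ `|x|) ?normr_gt0 // (le_trans _ (AM x)).
by rewrite ger0_norm.
Qed.

Let opnorm_ge0 A : 0 <= opnorm A.
Proof.
apply: ub_le_sup; first exact: opnorm_ub.
by exists 0; rewrite /= ?normr0 ?ler01 // linear0 normr0.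
Qed.

Fact le_opnorm A x : `|A x| <= (opnorm A)%:C * `|x|.
Proof.
have [->|x0] := eqVneq x 0; first by rewrite linear0 !normr0 mulr0.
have xgt0 : 0 < `|x| by rewrite normr_gt0.
rewrite -ler_pdivrMr // mulrC -[X in X * _]ger0_norm ?invr_ge0 //.
have : `| `|x|^-1 *: x| <= 1 by rewrite normfZV.
rewrite -normrZ -linearZ; move: (_ *: x) => y y1.
by rewrite -[leLHS]normE lecR; apply: (ub_le_sup (opnorm_ub A)); exists y.
Qed.

Fact opnorm_le A (M : R) : 0 <= M ->
  (forall x, `|A x| <= M%:C * `|x|) -> opnorm A <= M.
Proof.
move=> M0 AM; apply: ge_sup.
  by exists 0, 0; rewrite /= ?normr0 ?ler01 // linear0 normr0.
move=> _ [x /= x1 <-]; rewrite -lecR normE (le_trans (AM x)) //.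
by rewrite ler_piMr // ler0c.
Qed.

Let opnormD A B : (opnorm (A + B))%:C <= (opnorm A)%:C + (opnorm B)%:C.
Proof.
rewrite -rmorphD lecR; apply: opnorm_le; first by rewrite addr_ge0.
move=> x; rewrite rmorphD mulrDl.
by rewrite (le_trans (ler_normD _ _)) // lerD // le_opnorm.
Qed.

Let opnormZ_le (a : R[i]) A : (opnorm (a *: A))%:C <= `|a| * (opnorm A)%:C.
Proof.
have aE : (complex.Re `|a|)%:C = `|a| by rewrite RRe_real // normr_real.
rewrite -aE -rmorphM lecR; apply: opnorm_le.
  by rewrite mulr_ge0 // -ler0c aE.
move=> x; rewrite rmorphM -[X in X * (opnorm A)%:C]/`|a|.
by rewrite normrZ -mulrA ler_wpM2l // le_opnorm.
Qed.

Let opnormZ (a : R[i]) A : (opnorm (a *: A))%:C = `|a| * (opnorm A)%:C.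
Proof.
apply/eqP; rewrite eq_le opnormZ_le /=.
have [->|a0] := eqVneq a 0; first by rewrite normr0 mul0r ler0c.
rewrite -ler_pdivlMl ?normr_gt0 // -normfV.
by rewrite (le_trans _ (opnormZ_le _ _)) // scalerA mulVf // scale1r.
Qed.

Let opnorm_eq0 A : (opnorm A)%:C = 0 -> A = 0.
Proof.
move=> A0; apply: val_inj; apply/funext => x /=.
apply/eqP; rewrite -normr_le0 (le_trans (le_opnorm A x)) //.
by rewrite A0 mul0r.
Qed.

HB.instance Definition _ := Lmodule_isNormed.Build R[i] boundedOp
  opnormD opnormZ opnorm_eq0.

End BoundedOperators.

Notation "''B' ( H , K )" := (boundedOp H K)
  (at level 8, format "''B' ( H ,  K )") : type_scope.

Section Composition.
Context (R : realType).

Fact bcomp_subproof (H K L : hilbertType R) (A : 'B(K, L)) (B : 'B(H, K)) :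
  (A \o B) \in @bounded_linear R H L.
Proof.
rewrite inE; split=> [a u v|]; first by rewrite /= !linearP.
exists ((opnorm A)%:C * (opnorm B)%:C) => x /=.
rewrite (le_trans (le_opnorm A _)) // -mulrA ler_wpM2l ?le_opnorm //.
by rewrite -[_%:C]/`|A|.
Qed.

Definition bcomp (H K L : hilbertType R) (A : 'B(K, L)) (B : 'B(H, K)) :
  'B(H, L) := BoundedOp (bcomp_subproof A B).

Fact bid_subproof (H : hilbertType R) : idfun \in @bounded_linear R H H.
Proof. by rewrite inE; split=> //; exists 1 => x; rewrite mul1r. Qed.

Definition bid (H : hilbertType R) : 'B(H, H) := BoundedOp (bid_subproof H).

(* The set below is a singleton by the Riesz representation theorem, so the
   default value 0 is never used. *)
Definition badj (H K : hilbertType R) (A : 'B(H, K)) : 'B(K, H) :=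
  xget 0 [set B : 'B(K, H) | forall x y, '[A x, y] = '[x, B y]].

End Composition.

Notation "A \ob B" := (bcomp A B)
  (at level 40, left associativity) : ring_scope.
Notation "A ^†" := (badj A) (at level 2, format "A ^†") : ring_scope.

Section Definitions.
Context (R : realType).
Implicit Types H K : hilbertType R.

Definition unitary_op H K (U : 'B(H, K)) : Prop :=
  U^† \ob U = bid H /\ U \ob U^† = bid K.

Definition op_le H (A B : 'B(H, H)) : Prop :=
  forall x, 0 <= '[(B - A) x, x].

Definition cuntz_rep d H (S : 'I_d -> 'B(H, H)) : Prop :=
  (forall i j, (S i)^† \ob S j = if i == j then bid H else 0) /\
  \sum_(i < d) S i \ob (S i)^† = bid H.

Record cstar_subalgebra H (M : set 'B(H, H)) : Prop := CstarSubalgebra {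
  cstar0 : M 0;
  cstarP : forall (a : R[i]) A B, M A -> M B -> M (a *: A + B);
  cstarM : forall A B, M A -> M B -> M (A \ob B);
  cstar_adj : forall A, M A -> M A^†;
  cstar_closed : closed M
}.

Definition cstar_generated d H (S : 'I_d -> 'B(H, H)) : set 'B(H, H) :=
  smallest (@cstar_subalgebra H) (range S).

Definition commutant d H (S : 'I_d -> 'B(H, H)) : set 'B(H, H) :=
  [set A | forall i, A \ob S i = S i \ob A /\ A \ob (S i)^† = (S i)^† \ob A].

Definition lin_span H (X : set H) : set H :=
  [set y | exists (n : nat) (c : 'I_n -> R[i]) (v : 'I_n -> H),
    (forall k, X (v k)) /\ y = \sum_(k < n) c k *: v k].

(* An inclusion of K in a larger Hilbert space H is given by an isometric
   linear map [J : 'B(K, H)]; a subset of K is then identified with its image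
   under J. *)
Definition cyclic_for d K H (S : 'I_d -> 'B(H, H)) (J : 'B(K, H)) : Prop :=
  dense (lin_span [set A (J k) | A in cstar_generated S & k in setT]).

(* P, with values in K, is the orthogonal projection of H onto J(K). *)
Definition orthogonal_projection K H (J : 'B(K, H)) (P : 'B(H, K)) : Prop :=
  forall x k, '[x - J (P x), J k] = 0.

(* [dilation V J S P]: (H, S, P) is a system as in the dilation theorem for V.
   Operators "on K" such as P S_i^* P are read as [P \ob (S i)^† \ob J]. *)
Record dilation d K (V : 'I_d -> 'B(K, K)) H (J : 'B(K, H))
    (S : 'I_d -> 'B(H, H)) (P : 'B(H, K)) : Prop := Dilation {
  dilation_embedding : isometry (@inner R H) (@inner R K) J;
  dilation_rep : cuntz_rep S;
  dilation_proj : orthogonal_projection J P;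
  dilation_invariant : forall i k, range J ((S i)^† (J k));
  dilation_compress : forall i, P \ob (S i)^† \ob J = (V i)^†;
  dilation_cyclic : cyclic_for S J
}.

Definition unitarily_equivalent d K H H' (J : 'B(K, H)) (S : 'I_d -> 'B(H, H))
    (J' : 'B(K, H')) (S' : 'I_d -> 'B(H', H')) : Prop :=
  exists U : 'B(H, H'), [/\ unitary_op U,
    forall i, U \ob S i = S' i \ob U & U \ob J = J'].

Definition sigma d K (V : 'I_d -> 'B(K, K)) (A : 'B(K, K)) : 'B(K, K) :=
  \sum_(i < d) V i \ob A \ob (V i)^†.

Definition intertwiners d H H' (S : 'I_d -> 'B(H, H))
    (T : 'I_d -> 'B(H', H')) : set 'B(H, H') :=
  [set U | forall i, U \ob S i = T i \ob U].

End Definitions.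

(* Main.v *)
Require Import Defs.
From HB Require Import structures.
From mathcomp Require Import all_boot all_order all_algebra.
From mathcomp Require Import sesquilinear complex.
From mathcomp Require Import all_classical all_reals topology normedtype.
From mathcomp Require Import sequences interval_inference ring lra.

(* In a dilation, x is determined by the vectors f w = P S_w^* x indexed by the
   words w in the generators, since the S_w K span a dense subspace. They
   satisfy f w = sum_i V_i f (w i), and sum_(|w| = n) |f w|^2 increases to
   |x|^2. The bounded "martingales" f therefore form a Hilbert space on which
   prepending and deleting letters is a Cuntz representation: this is H_V.

   If X = sum_i W_i X V_i^*, put U_n = sum_(|w| = n) T_w J_W X P_V S_w^*. On the
   image of K the vectors U_n x have orthogonal increments and are bounded,
   hence converge; as U_(n+1) S_i = T_i U_n, they converge on a dense subspace,
   and everywhere by uniform boundedness. The limit is the intertwiner attached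
   to X, of norm at most |X|. Cyclicity makes the correspondence injective. The
   commutant is the case W = V, and the unitary equivalence of two dilations is
   the intertwiner attached to X = 1. *)

Set Implicit Arguments.
Unset Strict Implicit.
Unset Printing Implicit Defensive.

Import Order.TTheory GRing.Theory Num.Theory numFieldNormedType.Exports.

Local Open Scope classical_set_scope.
Local Open Scope complex_scope.
Local Open Scope ring_scope.

(** * Real-valued norms *)

Section RealNorm.
Context (R : realType).

(** Norms take values in [R[i]], so estimates and limits are carried out with the real number
    [rnorm x]. Adjoints are picked by [xget], so their defining property rests on Riesz
    representation, obtained here by minimizing a quadratic functional. Sums over the words of
    length n are never indexed by a set of words: [push] and [wform] recurse one letter at a time,
    so that each induction uses only one-letter relations. The isometry in (2) and (3) comes from
    two opposite contractions, compression and lifting. In the order statement of (2) the obstacle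
    is to carry positivity from K to H; the lift of X = 1 serves a second time there, as an
    approximation of the identity of H by sums of S_w J P S_w^*. *)

Definition rnorm (V : normedModType R[i]) (x : V) : R := complex.Re `|x|.

Lemma rnormE (V : normedModType R[i]) (x : V) : (rnorm x)%:C = `|x|.
Proof. by rewrite /rnorm RRe_real // normr_real. Qed.

Lemma gt0_complexE (e : R[i]) : 0 < e -> exists2 r : R, 0 < r & e = r%:C.
Proof.
move=> e0; have eE : (complex.Re e)%:C = e by rewrite RRe_real // gtr0_real.
by exists (complex.Re e); rewrite -?ltcR ?eE.
Qed.

Section NormedModule.
Context (V : normedModType R[i]).
Implicit Types x y : V.

Lemma rnorm_ge0 x : 0 <= rnorm x.
Proof. by rewrite -lecR rnormE normr_ge0. Qed.

Lemma rnormD x y : rnorm (x + y) <= rnorm x + rnorm y.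
Proof. by rewrite -lecR rmorphD /= !rnormE ler_normD. Qed.

Lemma rnormBC x y : rnorm (x - y) = rnorm (y - x).
Proof. by rewrite /rnorm distrC. Qed.

Lemma rnorm_le0 x : rnorm x <= 0 -> x = 0.
Proof. by rewrite -lecR rnormE normr_le0 => /eqP. Qed.

Lemma cvg_rnormP {T : Type} {F : set_system T} {FF : Filter F} (u : T -> V) x :
  u @ F --> x <->
  forall e : R, 0 < e -> \forall t \near F, rnorm (x - u t) < e.
Proof.
split=> [/cvgrPdist_lt h e e0|h].
  by near=> n; rewrite -ltcR rnormE; near: n; apply: h; rewrite ltcR.
apply/cvgrPdist_lt => _ /gt0_complexE[e e0 ->].
by near=> n; rewrite -rnormE ltcR; near: n; exact: h.
Unshelve. all: by end_near. Qed.

Lemma cvg_rnorm_le (u : nat -> V) x (M : R) :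
  u @ \oo --> x -> (forall n, rnorm (u n) <= M) -> rnorm x <= M.
Proof.
move=> /cvg_rnormP ux uM; apply/ler_addgt0Pl => e e0.
have [N _ /(_ N (leqnn N)) /= xN] := ux _ e0.
rewrite -[x](subrK (u N)) (le_trans (rnormD _ _)) //.
by rewrite lerD // ltW.
Qed.

Lemma closed_rnormP (A : set V) :
  (forall x, (forall e : R, 0 < e -> exists2 y, A y & rnorm (x - y) < e) ->
     A x) <-> closed A.
Proof.
split=> [h x clx|clA x h].
  apply: h => e e0; have := clx (ball x e%:C).
  case; first by apply: nbhsx_ballx; rewrite ltcR.
  move=> y [Ay]; rewrite -ball_normE /= => xy.
  by exists y => //; rewrite -ltcR rnormE.
apply: clA => B /nbhs_ballP[_ /gt0_complexE[e e0 ->]] xB.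
have [y Ay xy] := h _ e0; exists y; split=> //; apply: xB.
by rewrite -ball_normE /= -rnormE ltcR.
Qed.

Lemma dense_rnormP (A : set V) :
  dense A <->
  forall x (e : R), 0 < e -> exists2 y, A y & rnorm (x - y) < e.
Proof.
split=> [dA x e e0|h O [x Ox] oO].
  have e0C : 0 < e%:C by rewrite ltcR.
  have [||y [+ Ay]] := dA (ball x e%:C)^°; last 1 first.
  - move=> /interior_subset; rewrite -ball_normE /= => xy.
    by exists y => //; rewrite -ltcR rnormE.
  - exists x; apply: nbhs_singleton; apply: nbhs_interior.
    exact: nbhsx_ballx.
  - exact: open_interior.
have /nbhs_ballP[_ /gt0_complexE[e e0 ->] xO] := open_nbhs_nbhs (conj oO Ox).
have [y Ay xy] := h x _ e0; exists y; split=> //; apply: xO.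
by rewrite -ball_normE /= -rnormE ltcR.
Qed.

End NormedModule.

Lemma cauchy_rnorm_cvg (V : completeNormedModType R[i]) (u : nat -> V) :
  (forall e : R, 0 < e ->
     exists N, forall n m, (N <= m <= n)%N -> rnorm (u n - u m) < e) ->
  cvg (u @ \oo).
Proof.
move=> h; apply: cauchy_cvg; apply: cauchy_exP => _ /gt0_complexE[e e0 ->].
have [N uN] := h _ e0; exists (u N); exists N => // n /= Nn.
by rewrite -ball_normE /= -rnormE ltcR rnormBC uN // leqnn.
Qed.

End RealNorm.

(** * Inner products, the Riesz theorem and adjoints *)

Section InnerProduct.
Context (R : realType).

Lemma Re_conj (z : R[i]) : complex.Re (Num.conj z) = complex.Re z.
Proof. by case: z. Qed.

Lemma ReD (z w : R[i]) : complex.Re (z + w) = complex.Re z + complex.Re w.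
Proof. by case: z w => [a b] [c e]. Qed.

Lemma ReM_real (r : R) (z : R[i]) : complex.Re (r%:C * z) = r * complex.Re z.
Proof. by case: z => a b; rewrite /= mul0r subr0. Qed.

(** Stated for any dot product on a module, as it also has to give the triangle inequality of
    [dot_norm], from which the martingale space gets its norm. *)
Lemma cauchy_schwarz (U : lmodType R[i]) (f : {dot U for @Num.conj R[i]})
    (u v : U) : `|f u v| ^+ 2 <= f u u * f v v.
Proof.
have [->|v0] := eqVneq v 0.
  by rewrite !linear0r normr0 expr0n mulr0.
have vgt0 : 0 < f v v by rewrite dnorm_gt0.
have := dnorm_ge0 f (u - (f u v / f v v) *: v).
rewrite dnormB dnormZ linearZr_LR /=.
set a := f u v; set b := f v v in vgt0 *.
have bE : Num.conj b = b by apply: conj_Creal; rewrite gtr0_real.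
have b0 : b != 0 by rewrite gt_eqF.
have -> : (a / b)^* = a^* / b by rewrite rmorphM fmorphV /= bE.
have -> : (a^* / b * a)^* = a^* / b * a.
  by rewrite !rmorphM fmorphV /= conjCK bE; ring.
rewrite normrM exprMn normfV (gtr0_norm vgt0) normCK => h.
rewrite -subr_ge0 -(@pmulr_lge0 _ b^-1) ?invr_gt0 //.
apply: le_trans h _; rewrite le_eqVlt; apply/orP; left; apply/eqP.
by field.
Qed.

Context (H : hilbertType R).
Implicit Types x y z : H.

Lemma innerDl x y z : '[x + y, z] = '[x, z] + '[y, z].
Proof. by rewrite linearDl. Qed.
Lemma innerDr x y z : '[x, y + z] = '[x, y] + '[x, z].
Proof. by rewrite linearDr. Qed.
Lemma innerBl x y z : '[x - y, z] = '[x, z] - '[y, z].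
Proof. by rewrite linearBl. Qed.
Lemma innerBr x y z : '[x, y - z] = '[x, y] - '[x, z].
Proof. by rewrite linearBr. Qed.
Lemma innerZl (a : R[i]) x y : '[a *: x, y] = a * '[x, y].
Proof. by rewrite linearZl_LR. Qed.
Lemma innerZr (a : R[i]) x y : '[x, a *: y] = Num.conj a * '[x, y].
Proof. by rewrite linearZr_LR. Qed.
Lemma inner0l x : '[0, x] = 0 :> R[i].
Proof. by rewrite linear0l. Qed.
Lemma inner0r x : '[x, 0] = 0 :> R[i].
Proof. by rewrite linear0r. Qed.
Lemma inner_suml (I : finType) (F : I -> H) x :
  '[\sum_i F i, x] = \sum_i '[F i, x].
Proof. by rewrite linear_sumlz. Qed.
Lemma inner_sumr (I : finType) (F : I -> H) x :
  '[x, \sum_i F i] = \sum_i '[x, F i].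
Proof. by rewrite linear_sumr. Qed.
Lemma innerC x y : '[x, y] = Num.conj '[y, x].
Proof. by rewrite hermC mul1r. Qed.

Lemma inner_rnorm x : '[x, x] = (rnorm x ^+ 2)%:C.
Proof. by rewrite rmorphXn /= rnormE inner_norm. Qed.

Lemma rnorm_sqr x : rnorm x ^+ 2 = complex.Re '[x, x].
Proof. by rewrite inner_rnorm. Qed.

Lemma rnormD_sqr x y :
  rnorm (x + y) ^+ 2 = rnorm x ^+ 2 + 2 * complex.Re '[x, y] + rnorm y ^+ 2.
Proof.
rewrite !rnorm_sqr innerDl !innerDr !ReD (innerC y x) Re_conj.
by rewrite mulr2n mulrDl mul1r; lra.
Qed.

Lemma rnormB_sqr x y :
  rnorm (x - y) ^+ 2 = rnorm x ^+ 2 - 2 * complex.Re '[x, y] + rnorm y ^+ 2.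
Proof.
have rN : rnorm (- y) = rnorm y by rewrite /rnorm normrN.
rewrite rnormD_sqr rN -scaleN1r innerZr rmorphN1 mulN1r.
have -> : complex.Re (- '[x, y]) = - complex.Re '[x, y] by case: '[x, y].
by rewrite mulrN.
Qed.

Lemma normr_inner_le x y : `|'[x, y]| <= (rnorm x * rnorm y)%:C.
Proof.
have := cauchy_schwarz (@inner R H) x y.
have -> : '[x, x] * '[y, y] = (rnorm x * rnorm y)%:C ^+ 2 :> R[i].
  by rewrite !inner_rnorm -rmorphM -exprMn rmorphXn.
by rewrite ler_pXn2r ?nnegrE ?normr_ge0 // ler0c mulr_ge0 // rnorm_ge0.
Qed.

Lemma Re_inner_le x y : `|complex.Re '[x, y]| <= rnorm x * rnorm y.
Proof. by rewrite -lecR (le_trans (normc_ge_Re _)) // normr_inner_le. Qed.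

Lemma inner_ext x y : (forall z, '[x, z] = '[y, z]) -> x = y.
Proof.
move=> h; apply/eqP; rewrite -subr_eq0 -(dnorm_eq0 (@inner R H)).
by rewrite -/('[_, _]) innerBl h subrr.
Qed.

End InnerProduct.

Section Riesz.
Context (R : realType) (H : hilbertType R).

Lemma le0_quadratic (b c : R) :
  (forall t : R, 0 <= t ^+ 2 * b + 2 * t * c) -> 0 <= b -> c = 0.
Proof.
move=> h b0; have b1 : 0 < b + 1 by lra.
(* The minimizer would be [- c / b]; [b + 1] avoids division by zero and still gives a negative
   value unless c = 0. *)
have := h (- c / (b + 1)).
have -> : (- c / (b + 1)) ^+ 2 * b + 2 * (- c / (b + 1)) * c =
    - (c ^+ 2 * ((b + 2) / (b + 1) ^+ 2)) by field; rewrite gt_eqF.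
rewrite oppr_ge0 pmulr_lle0; last by rewrite divr_gt0 ?exprn_gt0 //; lra.
by move=> c2; apply/eqP; rewrite -sqrf_eq0 eq_le c2 sqr_ge0.
Qed.

(** If y represents r, then the functional Q below is |x - y|^2 - |y|^2; so y is found as its
    minimizer, in the real inner product Re '[x, y]. *)
Lemma real_riesz (r : H -> R) (M : R) :
  (forall x y, r (x + y) = r x + r y) ->
  (forall (t : R) x, r (t%:C *: x) = t * r x) ->
  (forall x, r x <= M * rnorm x) ->
  exists y, forall x, r x = complex.Re '[y, x].
Proof.
move=> rD rZ rM.
pose Q x := rnorm x ^+ 2 - 2 * r x.
have Qlb : lbound (range Q) (- M ^+ 2).
  move=> _ [x _ <-]; rewrite /Q; have := rM x.
  have := sqr_ge0 (rnorm x - M); nra.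
have Qinf : has_inf (range Q).
  by split; [exists (Q 0), 0 | exists (- M ^+ 2)].
set m := inf (range Q).
have mQ x : m <= Q x by apply: ge_inf; [exact: (proj2 Qinf) | exists x].
have /choice[u uQ] : forall n : nat, exists x, Q x < m + n.+1%:R^-1.
  move=> n; have [|_ [x _ <-] Qx] := inf_adherent _ Qinf (eps := n.+1%:R^-1).
    by rewrite invr_gt0.
  by exists x.
have sqr_lin (t : R) x y : Q (x + t%:C *: y) =
    Q x + t ^+ 2 * rnorm y ^+ 2 + 2 * t * (complex.Re '[x, y] - r y).
  rewrite /Q rnormD_sqr rD rZ innerZr.
  have -> : Num.conj t%:C = t%:C by apply: conj_Creal; rewrite complex_real.
  have -> : rnorm (t%:C *: y) ^+ 2 = t ^+ 2 * rnorm y ^+ 2.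
    by rewrite !rnorm_sqr innerZl innerZr
      (_ : Num.conj t%:C = t%:C) ?ReM_real;
      [ring | apply: conj_Creal; rewrite complex_real].
  by rewrite ReM_real; ring.
have par x y : rnorm (x - y) ^+ 2 <= 2 * (Q x - m) + 2 * (Q y - m).
  (* Q is at least m at the midpoint of x and y; with the parallelogram law this makes minimizing
     sequences Cauchy. *)
  have := mQ (x + (- 2^-1)%:C *: (x - y)); rewrite sqr_lin innerBr.
  have := rnormB_sqr x y; rewrite /Q.
  have -> : complex.Re ('[x, x] - '[x, y]) = rnorm x ^+ 2 - complex.Re '[x, y].
    rewrite rnorm_sqr.
    by case: '[x, x] => ? ?; case: '[x, y].
  have -> : r (x - y) = r x - r y.
    by rewrite -scaleN1r rD -[-1](rmorphN1 (real_complex R)) rZ mulN1r.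
  lra.
have /cvg_ex[/= x0 ux0] : cvg (u @ \oo).
  apply: cauchy_rnorm_cvg => e e0.
  have e2 : 0 < e ^+ 2 / 4 by rewrite divr_gt0 // exprn_gt0.
  have [N _ hN] := near_infty_natSinv_lt (PosNum e2).
  exists N => n k /andP[Nk kn].
  rewrite -(@ltr_pXn2r _ 2) ?nnegrE ?rnorm_ge0 ?ltW //.
  apply: le_lt_trans (par _ _) _.
  have := hN n (leq_trans Nk kn); have := hN k Nk; rewrite /=.
  have := uQ n; have := uQ k.
  move: (Q _) (Q _) (_ ^-1) (_ ^-1) (_ ^+ 2) => ? ? ? ? ?; lra.
exists x0 => y; apply/esym/eqP; rewrite -subr_eq0; apply/eqP.
apply: (@le0_quadratic (rnorm y ^+ 2)); last exact: sqr_ge0.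
(* Instead of showing that Q attains m at [x0], the inequality m <= Q (u n + t y) is compared with Q
   (u n) < m + 1/(n+1). The excess 1/(n+1) and the replacement of [u n] by [x0] in the linear term
   cost at most e / 2 each. *)
move=> t; apply/ler_addgt0Pl => e e0.
pose b := 2 * `|t| * rnorm y + 1.
have b0 : 0 < b.
  by rewrite /b ltr_wpDl // mulr_ge0 ?rnorm_ge0 // mulr_ge0.
have e2 : 0 < e / 2 by lra.
have [N1 _ h1] := near_infty_natSinv_lt (PosNum e2).
have /cvg_rnormP/(_ (e / 2 / b))[|N2 _ h2] := ux0; first by rewrite divr_gt0.
pose n := maxn N1 N2.
have := h1 n (leq_maxl _ _); have := h2 n (leq_maxr _ _); rewrite /= => xn nlt.
have := mQ (u n + t%:C *: y); rewrite sqr_lin => hQ.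
have := uQ n => un.
have : 2 * t * (complex.Re '[u n, y] - complex.Re '[x0, y]) <= e / 2.
  have -> : complex.Re '[u n, y] - complex.Re '[x0, y] =
      complex.Re '[u n - x0, y].
    by rewrite innerBl; case: '[u n, y] => ? ?; case: '[x0, y].
  apply: le_trans (ler_norm _) _.
  rewrite normrM normrM (ger0_norm (_ : 0 <= 2)) //.
  apply: (@le_trans _ _ (2 * `|t| * (rnorm (u n - x0) * rnorm y))).
    by rewrite ler_wpM2l // ?mulr_ge0 // Re_inner_le.
  have : rnorm (x0 - u n) * b <= e / 2 by rewrite -ler_pdivlMr // ltW.
  rewrite rnormBC /b; have := rnorm_ge0 (u n - x0); nra.
move: hQ un nlt.
move: (_^-1) (Q _) (complex.Re _) (complex.Re _) (rnorm y ^+ 2) => v q c c' b'.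
lra.
Qed.

(** A complex-linear functional is determined by its real part, since Im (phi x) = - Re (phi ('i
    x)); so the real case suffices. *)
Lemma riesz (phi : H -> R[i]) (M : R) : scalar phi ->
  (forall x, complex.Re (phi x) <= M * rnorm x) ->
  exists y, forall x, phi x = '[x, y].
Proof.
move=> lphi phiM.
have phiD x y : phi (x + y) = phi x + phi y.
  by have := lphi 1 x y; rewrite !scale1r mul1r.
have phi0 : phi 0 = 0 by apply: (addrI (phi 0)); rewrite -phiD !addr0.
have phiZ a x : phi (a *: x) = a * phi x.
  by have := lphi a x 0; rewrite !addr0 phi0 addr0.
have [||//|y hy] := @real_riesz (fun x => complex.Re (phi x)) M.
- by move=> x y; rewrite phiD ReD.
- by move=> t x; rewrite phiZ ReM_real.
exists y => x.
have hRe z : complex.Re (phi z) = complex.Re '[z, y].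
  by rewrite hy innerC Re_conj.
have := hRe x; have := hRe ('i *: x); rewrite phiZ innerZl.
case: (phi x) => a b; case: '[x, y] => c e /=.
by rewrite !mul0r !sub0r !mul1r => /oppr_inj -> ->.
Qed.

End Riesz.

Section Operators.
Context (R : realType).
Implicit Types H K L : hilbertType R.

Lemma ler_of_sqr (a b : R) : 0 <= b -> a ^+ 2 <= a * b -> a <= b.
Proof. by move=> b0 h; rewrite leNgt; apply/negP => ba; nra. Qed.

Lemma bop_ext H K (A B : 'B(H, K)) : (forall x, A x = B x) -> A = B.
Proof. by move=> h; apply: val_inj; apply/funext. Qed.

Lemma bopDE H K (A B : 'B(H, K)) x : (A + B) x = A x + B x.
Proof. by []. Qed.

Lemma bopZE H K (a : R[i]) (A : 'B(H, K)) x : (a *: A) x = a *: A x.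
Proof. by []. Qed.

Lemma bop_sumE H K (I : finType) (A : I -> 'B(H, K)) x :
  (\sum_i A i) x = \sum_i A i x.
Proof. by elim/big_ind2: _ => // a y b z <- <-. Qed.

Lemma bop_rnorm H K (A : 'B(H, K)) : rnorm A = opnorm A.
Proof. by apply: complexI; rewrite rnormE. Qed.

Lemma rnorm_bop_le H K (A : 'B(H, K)) x : rnorm (A x) <= rnorm A * rnorm x.
Proof.
by have := le_opnorm A x; rewrite -!rnormE -rmorphM lecR bop_rnorm.
Qed.

Lemma bop_rnorm_le H K (A : 'B(H, K)) (M : R) : 0 <= M ->
  (forall x, rnorm (A x) <= M * rnorm x) -> rnorm A <= M.
Proof.
move=> M0 h; rewrite bop_rnorm opnorm_le // => x.
by rewrite -!rnormE -rmorphM lecR.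
Qed.

Lemma bop_of_linear H K (f : H -> K) (M : R) : linear f ->
  (forall x, rnorm (f x) <= M * rnorm x) -> exists A : 'B(H, K), A =1 f.
Proof.
move=> lf fM; suff fb : f \in @bounded_linear R H K.
  by exists (BoundedOp fb).
rewrite inE; split=> //; exists M%:C => x.
by rewrite -!rnormE -rmorphM lecR.
Qed.

Lemma cvg_bop {T : Type} {F : set_system T} {FF : Filter F} H K
    (A : 'B(H, K)) (u : T -> H) x : u @ F --> x -> A (u t) @[t --> F] --> A x.
Proof.
move=> /cvg_rnormP ux; apply/cvg_rnormP => e e0.
have A1 : 0 < rnorm A + 1 by rewrite ltr_wpDl ?rnorm_ge0.
near=> n; rewrite -linearB (le_lt_trans (rnorm_bop_le _ _)) //.
have : rnorm (x - u n) < e / (rnorm A + 1).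
  by near: n; apply: ux; rewrite divr_gt0.
rewrite ltr_pdivlMr //; apply: le_lt_trans.
by rewrite mulrC ler_wpM2l ?rnorm_ge0 // lerDl.
Unshelve. all: by end_near. Qed.

(** As soon as one adjoint is exhibited, [xget] can only pick that one. *)
Lemma badj_uniq H K (A : 'B(H, K)) (B : 'B(K, H)) :
  (forall x y, '[A x, y] = '[x, B y]) -> A^† = B.
Proof.
move=> AB; apply: xget_unique => // C AC; apply: bop_ext => y.
by apply: inner_ext => x; rewrite innerC -AC AB -innerC.
Qed.

Lemma badj_exists H K (A : 'B(H, K)) :
  exists B : 'B(K, H), forall x y, '[A x, y] = '[x, B y].
Proof.
have /choice[f fA] : forall y, exists z, forall x, '[A x, y] = '[x, z].
  move=> y; apply: (@riesz _ _ _ (rnorm A * rnorm y)) => [a u v|x].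
    by rewrite linearP innerDl innerZl.
  apply: le_trans (ler_norm _) _; apply: le_trans (Re_inner_le _ _) _.
  by rewrite mulrAC ler_wpM2r ?rnorm_ge0 // rnorm_bop_le.
have [||B BE] := @bop_of_linear _ _ f (rnorm A).
- move=> a u v; apply: inner_ext => x.
  rewrite innerC -fA innerDr innerZr !fA -innerZr -innerDr -innerC.
  by [].
- move=> y; apply: ler_of_sqr; first by rewrite mulr_ge0 // rnorm_ge0.
  rewrite rnorm_sqr -fA.
  apply: le_trans (ler_norm _) _; apply: le_trans (Re_inner_le _ _) _.
  by rewrite mulrCA mulrA ler_wpM2r ?rnorm_ge0 // rnorm_bop_le.
by exists B => x y; rewrite BE.
Qed.

Lemma badjE H K (A : 'B(H, K)) x y : '[A x, y] = '[x, A^† y].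
Proof. by have [B AB] := badj_exists A; rewrite (badj_uniq AB). Qed.

Lemma badjEr H K (A : 'B(H, K)) x y : '[x, A y] = '[A^† x, y].
Proof. by rewrite innerC badjE -innerC. Qed.

Lemma badjK H K (A : 'B(H, K)) : A^†^† = A.
Proof. by apply: badj_uniq => x y; rewrite badjEr. Qed.

Lemma badjM H K L (A : 'B(K, L)) (B : 'B(H, K)) :
  (A \ob B)^† = B^† \ob A^†.
Proof. by apply: badj_uniq => x y /=; rewrite !badjE. Qed.

Lemma badjP H K (a : R[i]) (A B : 'B(H, K)) :
  (a *: A + B)^† = Num.conj a *: A^† + B^†.
Proof.
apply: badj_uniq => x y.
by rewrite !bopDE !bopZE innerDl innerDr innerZl innerZr conjCK !badjE.
Qed.

Lemma badjB H K (A B : 'B(H, K)) : (A - B)^† = A^† - B^†.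
Proof. by rewrite addrC -scaleN1r badjP rmorphN1 scaleN1r addrC. Qed.

Lemma badj0 H K : (0 : 'B(H, K))^† = 0.
Proof. by apply: badj_uniq => x y; rewrite inner0l inner0r. Qed.

Lemma rnorm_badj_le H K (A : 'B(H, K)) : rnorm A^† <= rnorm A.
Proof.
apply: bop_rnorm_le => [|y]; first exact: rnorm_ge0.
apply: ler_of_sqr; first by rewrite mulr_ge0 // rnorm_ge0.
rewrite rnorm_sqr -badjE.
apply: le_trans (ler_norm _) _; apply: le_trans (Re_inner_le _ _) _.
by rewrite mulrCA mulrA ler_wpM2r ?rnorm_ge0 // rnorm_bop_le.
Qed.

End Operators.

(** * Strong limits *)

Section StrongLimits.
Context (R : realType).
Implicit Types H K L : hilbertType R.

(** The inequality makes [a] nondecreasing; past an index where [a] is within e^2 of its supremum,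
    all increments are shorter than e. For orthogonal increments, [a] is the squared norm. *)
Lemma cvg_of_sqr_increments (V : completeNormedModType R[i]) (u : nat -> V)
    (a : nat -> R) (M : R) : (forall n, a n <= M) ->
  (forall n m, (n <= m)%N -> rnorm (u m - u n) ^+ 2 <= a m - a n) ->
  cvg (u @ \oo).
Proof.
move=> aM ua; apply: cauchy_rnorm_cvg => e e0.
have sa : has_sup (range a).
  by split; [exists (a 0%N), 0%N | exists M => _ [n _ <-]].
have [_ [N _ <-] Na] := sup_adherent (exprn_gt0 2 e0) sa.
exists N => m n /andP[Nn nm].
rewrite -(@ltr_pXn2r _ 2) ?nnegrE ?rnorm_ge0 ?ltW //.
apply: le_lt_trans (ua _ _ nm) _.
have : a m <= sup (range a) by apply: ub_le_sup; [case: sa | exists m].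
have : 0 <= a n - a N by apply: le_trans (ua _ _ Nn); exact: sqr_ge0.
lra.
Qed.

Lemma closed_bop_preimage H K (A : 'B(H, K)) (F : set K) :
  closed F -> closed [set x | F (A x)].
Proof.
move=> /closed_rnormP clF; apply/closed_rnormP => x h; apply: clF => e e0.
have A1 : 0 < rnorm A + 1 by rewrite ltr_wpDl ?rnorm_ge0.
have [y Fy xy] := h _ (divr_gt0 e0 A1); exists (A y) => //.
rewrite -linearB (le_lt_trans (rnorm_bop_le _ _)) //.
rewrite ltr_pdivlMr // in xy; apply: le_lt_trans xy.
by rewrite mulrC ler_wpM2l ?rnorm_ge0 // lerDl.
Qed.

Lemma closed_orthogonal H (z : H) : closed [set x | '[z, x] = 0].
Proof.
apply/closed_rnormP => x h; apply/eqP; rewrite -normr_le0.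
have <- : (complex.Re `|'[z, x]|)%:C = `|'[z, x]|.
  by rewrite RRe_real // normr_real.
rewrite (lecR _ 0); apply/ler_addgt0Pl => e e0; rewrite addr0 -lecR.
rewrite RRe_real ?normr_real //.
have z1 : 0 < rnorm z + 1 by rewrite ltr_wpDl ?rnorm_ge0.
have [y /= zy xy] := h _ (divr_gt0 e0 z1).
have -> : '[z, x] = '[z, x - y] by rewrite innerBr zy subr0.
apply: le_trans (normr_inner_le _ _) _; rewrite lecR.
rewrite ltr_pdivlMr // in xy; apply: le_trans (ltW xy).
by rewrite mulrC ler_wpM2l ?rnorm_ge0 // lerDl.
Qed.

Lemma closed_cvg_bop H K (A : nat -> 'B(H, K)) (M : R) :
  (forall n x, rnorm (A n x) <= M * rnorm x) ->
  closed [set x | cvg (A n x @[n --> \oo])].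
Proof.
move=> AM; apply/closed_rnormP => x h; apply: cauchy_rnorm_cvg => e e0.
(* Four errors of e / 4: two from replacing x by y, two from convergence at y. Since M may be zero
   or negative, the divisor uses [|M| + 1]. *)
have [|y /cvg_ex[/= l /cvg_rnormP yl] xy] :=
    h (e / (4 * (`|M| + 1))).
  by rewrite divr_gt0 // mulr_gt0 // ltr_wpDl.
have e4 : 0 < e / 4 by lra.
have M1 : 0 < 4 * (`|M| + 1) by rewrite mulr_gt0 // ltr_wpDl.
have [N _ hN] := yl _ e4; exists N => n m /andP[Nm mn].
have xyM k : rnorm (A k x - A k y) <= e / 4.
  rewrite -linearB (le_trans (AM _ _)) //.
  rewrite ltr_pdivlMr // in xy.
  have := ler_norm M; have := rnorm_ge0 (x - y); have := normr_ge0 M.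
  nra.
have hn := hN n (leq_trans Nm mn); have hm := hN m Nm; rewrite /= in hn hm.
have -> : A n x - A m x =
    (A n x - A n y) - (l - A n y) + (l - A m y) - (A m x - A m y).
  by rewrite !opprB !addrA !subrK.
rewrite rnormBC in hn.
have := rnormD ((A n x - A n y) - (l - A n y) + (l - A m y))
  (- (A m x - A m y)).
have := rnormD ((A n x - A n y) - (l - A n y)) (l - A m y).
have := rnormD (A n x - A n y) (- (l - A n y)).
rewrite !opprB rnormBC in hn *.
have := xyM n; have := xyM m; rewrite (rnormBC (A m x)).
lra.
Qed.

Lemma strong_limit H K (A : nat -> 'B(H, K)) (M : R) : 0 <= M ->
  (forall n x, rnorm (A n x) <= M * rnorm x) ->
  (forall x, cvg (A n x @[n --> \oo])) ->
  exists2 B : 'B(H, K), rnorm B <= M & forall x, A n x @[n --> \oo] --> B x.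
Proof.
move=> M0 AM cA; pose f x : K := lim (A n x @[n --> \oo]).
have fP x : A n x @[n --> \oo] --> f x by exact: cA.
have fM x : rnorm (f x) <= M * rnorm x.
  by apply: cvg_rnorm_le (fP x) _ => n; exact: AM.
have [|B BE] := bop_of_linear (f := f) _ fM.
  move=> a x y; apply: (cvg_unique _ (fP (a *: x + y))) => //.
  have -> : (fun n => A n (a *: x + y)) = (fun n => a *: A n x + A n y).
    by apply/funext => n; rewrite linearP.
  by apply: cvgD => //; apply: cvgZr.
exists B => [|x]; last by rewrite BE.
by apply: bop_rnorm_le => // x; rewrite BE.
Qed.

End StrongLimits.

(** * Dilations and intertwiners *)

Section CuntzRepresentations.
Context (R : realType) (d : nat).
Implicit Types H K L : hilbertType R.

Lemma sum_rnorm_badj K (V : 'I_d -> 'B(K, K)) :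
  \sum_i V i \ob (V i)^† = bid K ->
  forall x, \sum_i rnorm ((V i)^† x) ^+ 2 = rnorm x ^+ 2.
Proof.
move=> hV x; apply: complexI; rewrite -inner_rnorm.
have {2}-> : x = (bid K) x by [].
rewrite -hV bop_sumE inner_suml rmorph_sum; apply: eq_bigr => i _.
by rewrite /= badjE inner_rnorm.
Qed.

Section Cuntz.
Context H (S : 'I_d -> 'B(H, H)) (cS : cuntz_rep S).

Lemma cuntz_badj_gen i j x : (S i)^† (S j x) = if i == j then x else 0.
Proof.
have := congr1 (fun A : 'B(H, H) => A x) (cS.1 i j) => /= ->.
by case: (i == j).
Qed.

Lemma cuntz_sum x : \sum_i S i ((S i)^† x) = x.
Proof.
have := congr1 (fun A : 'B(H, H) => A x) cS.2.
by rewrite bop_sumE.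
Qed.

Lemma cuntz_badj_sum (x : 'I_d -> H) i : (S i)^† (\sum_j S j (x j)) = x i.
Proof.
rewrite linear_sum (bigD1 i) //= cuntz_badj_gen eqxx big1 ?addr0 // => j ji.
by rewrite cuntz_badj_gen eq_sym (negbTE ji).
Qed.

Lemma cuntz_inner_sum (x y : 'I_d -> H) :
  '[\sum_i S i (x i), \sum_i S i (y i)] = \sum_i '[x i, y i].
Proof.
rewrite inner_suml; apply: eq_bigr => i _.
by rewrite badjE cuntz_badj_sum.
Qed.

End Cuntz.

(** Expanding x as the sum of the S_j S_j^* x turns U x into the sum of the T_j U S_j^* x, and T_i^*
    selects one term. Thus intertwining the generators forces intertwining their adjoints, and the
    commutant consists of the self-intertwiners. *)
Lemma intertwiner_badj H L (S : 'I_d -> 'B(H, H)) (T : 'I_d -> 'B(L, L))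
    (U : 'B(H, L)) : cuntz_rep S -> cuntz_rep T -> intertwiners S T U ->
  forall i x, (T i)^† (U x) = U ((S i)^† x).
Proof.
move=> cS cT UST i x.
have US j y : U (S j y) = T j (U y).
  by have := congr1 (fun A : 'B(H, L) => A y) (UST j).
rewrite -{1}(cuntz_sum cS x) linear_sum (eq_bigr _ (fun j _ => US j _)).
exact: cuntz_badj_sum.
Qed.

(* [push T Z X n] is the sum of T_w X Z_w' over the words w of length n, where
   w' is the reverse of w. *)
Fixpoint push H L (T : 'I_d -> 'B(L, L)) (Z : 'I_d -> 'B(H, H)) (X : 'B(H, L))
    (n : nat) : 'B(H, L) :=
  if n is m.+1 then \sum_i T i \ob push T Z X m \ob Z i else X.

Lemma pushS H L (T : 'I_d -> 'B(L, L)) (Z : 'I_d -> 'B(H, H)) (X : 'B(H, L))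
  n x : push T Z X n.+1 x = \sum_i T i (push T Z X n (Z i x)).
Proof. by rewrite /= bop_sumE. Qed.

(** The ranges of the T_i are orthogonal, so squared norms add up along the recursion, while the Z_i
    split |x|^2 exactly: no factor accumulates with n. *)
Lemma rnorm_push_le H L (T : 'I_d -> 'B(L, L)) (Z : 'I_d -> 'B(H, H))
    (X : 'B(H, L)) : cuntz_rep T ->
  (forall x, \sum_i rnorm (Z i x) ^+ 2 = rnorm x ^+ 2) ->
  forall n x, rnorm (push T Z X n x) <= rnorm X * rnorm x.
Proof.
move=> cT hZ n x.
rewrite -(@ler_pXn2r _ 2) ?nnegrE ?mulr_ge0 ?rnorm_ge0 // exprMn.
elim: n x => [|n IHn] x.
  rewrite /= -exprMn ler_pXn2r ?nnegrE ?mulr_ge0 ?rnorm_ge0 //.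
  exact: rnorm_bop_le.
rewrite -(hZ x) mulr_sumr; apply: le_trans (ler_sum _ (fun i _ => IHn (Z i x))).
rewrite -lecR -inner_rnorm pushS cuntz_inner_sum // rmorph_sum /=.
by under eq_bigr do rewrite inner_rnorm.
Qed.

End CuntzRepresentations.

Section Dilations.
Context (R : realType) (d : nat) (K H : hilbertType R).
Context (V : 'I_d -> 'B(K, K)) (J : 'B(K, H)) (S : 'I_d -> 'B(H, H)).
Context (P : 'B(H, K)) (D : dilation V J S P).

Lemma dilation_rnorm k : rnorm (J k) = rnorm k.
Proof.
apply/eqP; rewrite -(@eqrXn2 _ 2) ?rnorm_ge0 // !rnorm_sqr.
by rewrite (dilation_embedding D).
Qed.

Lemma dilation_projJ k : P (J k) = k.
Proof.
apply: inner_ext => l; rewrite -(dilation_embedding D).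
apply/eqP; rewrite eq_sym -(dilation_embedding D k) -subr_eq0 -innerBl.
by rewrite (dilation_proj D).
Qed.

Lemma dilation_proj_badj x k : '[P x, k] = '[x, J k].
Proof.
apply/eqP; rewrite -(dilation_embedding D) eq_sym -subr_eq0 -innerBl.
by rewrite (dilation_proj D).
Qed.

Lemma dilation_rnorm_proj x : rnorm (P x) <= rnorm x.
Proof.
apply: ler_of_sqr; first exact: rnorm_ge0.
rewrite rnorm_sqr dilation_proj_badj mulrC -[in leRHS]dilation_rnorm.
exact: le_trans (ler_norm _) (Re_inner_le _ _).
Qed.

Lemma dilation_badjJ i k : (S i)^† (J k) = J ((V i)^† k).
Proof.
have [l _ lE] := dilation_invariant D i k.
have := congr1 (fun A : 'B(K, K) => A k) (dilation_compress D i).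
by rewrite /= -lE dilation_projJ => ->.
Qed.

Lemma dilation_projS i x : P (S i x) = V i (P x).
Proof.
apply: inner_ext => k.
rewrite dilation_proj_badj badjE dilation_badjJ -dilation_proj_badj.
by rewrite [RHS]badjE.
Qed.

(* Invariance under the adjoints of the S_i need not be assumed: the smallest
   such [F] has it, because S_i^* S_j is 0 or 1 and S_i^* maps K to K. *)
Lemma dilation_ind (F : set H) : closed F ->
  (forall (a : R[i]) x y, F x -> F y -> F (a *: x + y)) ->
  (forall k, F (J k)) -> (forall i x, F x -> F (S i x)) -> forall x, F x.
Proof.
have cS := dilation_rep D.
pose good (F : set H) := [/\ closed F,
  forall (a : R[i]) x y, F x -> F y -> F (a *: x + y),
  forall k, F (J k) & forall i x, F x -> F (S i x)].
pose G := [set x | forall F, good F -> F x].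
have gG : good G.
  split=> [|a x y Gx Gy F0 gF|k F0 []//|i x Gx F0 gF].
  - apply/closed_rnormP => x h F0 gF.
    have [clF _ _ _] := gF; move/closed_rnormP: (clF); apply=> e e0.
    by have [y Gy xy] := h _ e0; exists y => //; exact: Gy.
  - by have [_ FP _ _] := gF; apply: FP; [exact: Gx | exact: Gy].
  - by have [_ _ _ FS] := gF; apply: FS; exact: Gx.
have [clG GP GJ GS] := gG.
have G0 : G 0 by have := GP (- 1) _ _ (GJ 0) (GJ 0); rewrite scaleN1r addNr.
(* G lies in every good set, so it suffices that the points of G which S_i^* sends into G form a
   good set. *)
have GSadj i x : G x -> G ((S i)^† x).
  move=> Gx; suff [] : (G `&` [set x | G ((S i)^† x)]) x by [].
  apply: Gx; split=> [|a y z [Gy Gy'] [Gz Gz']|k|j y [Gy _]].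
  - by apply: closedI => //; exact: closed_bop_preimage.
  - by split; rewrite /= ?linearP; exact: GP.
  - by split; rewrite /= ?dilation_badjJ; exact: GJ.
  - by split; [exact: GS | rewrite /= (cuntz_badj_gen cS); case: (i == j)].
(* Asking for both A and A^* to preserve G makes this set a C*-algebra; it contains the S_i, hence
   all that they generate. *)
pose stable := [set A : 'B(H, H) | forall x, G x -> G (A x) /\ G (A^† x)].
have cM : cstar_subalgebra stable.
  split.
  - by move=> x Gx; rewrite badj0.
  - move=> a A B sA sB x Gx; have [[GA GA'] [GB GB']] := (sA x Gx, sB x Gx).
    by rewrite badjP; split; apply: GP.
  - move=> A B sA sB x Gx; have [GA' GB] := ((sA x Gx).2, (sB x Gx).1).
    by rewrite badjM; split; [exact: (sA _ GB).1 | exact: (sB _ GA').2].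
  - by move=> A sA x Gx; rewrite badjK; have [] := sA x Gx.
  - apply/closed_rnormP => A h x Gx; move/closed_rnormP: clG => clG.
    have x1 : 0 < rnorm x + 1 by rewrite ltr_wpDl ?rnorm_ge0.
    have close (B C : 'B(H, H)) e : rnorm (B - C) < e / (rnorm x + 1) ->
        rnorm (B x - C x) < e.
      move=> BC; apply: le_lt_trans (rnorm_bop_le (B - C) x) _.
      rewrite ltr_pdivlMr // in BC; apply: le_lt_trans BC.
      by rewrite ler_wpM2l ?rnorm_ge0 // lerDl.
    split; apply: clG => e e0; have [B sB AB] := h _ (divr_gt0 e0 x1).
      by exists (B x); [exact: (sB x Gx).1 | exact: close].
    exists (B^† x); first exact: (sB x Gx).2.
    apply: close; apply: le_lt_trans AB.
    by rewrite -badjB; exact: rnorm_badj_le.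
have sub A : cstar_generated S A -> stable A.
  move=> h; apply: (h stable); split=> // _ [i _ <-] x Gx.
  by split; [exact: GS | exact: GSadj].
have GT x : G x.
  move/closed_rnormP: clG => clG; apply: clG => e e0.
  have /dense_rnormP/(_ x _ e0)[y + xy] := dilation_cyclic D.
  move=> [n [c [v [vP yE]]]]; exists y => //; rewrite {}yE.
  apply: (big_ind G) => [//|u w Gu Gw|k _].
    by have := GP 1 _ _ Gu Gw; rewrite scale1r.
  have [A /sub sA [l _ <-]] := vP k; rewrite -[_ *: _]addr0; apply: GP => //.
  by have [] := sA _ (GJ l).
by move=> clF FP FJ FS x; apply: GT.
Qed.

End Dilations.

Section Intertwiners.
Context (R : realType) (d : nat) (K HV HW : hilbertType R).
Context (V W : 'I_d -> 'B(K, K)).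
Context (JV : 'B(K, HV)) (S : 'I_d -> 'B(HV, HV)) (PV : 'B(HV, K)).
Context (JW : 'B(K, HW)) (T : 'I_d -> 'B(HW, HW)) (PW : 'B(HW, K)).
Context (DV : dilation V JV S PV) (DW : dilation W JW T PW).

(** Insert sum_i S_i S_i^* = 1 between U and J_V, move S_i through U, and use P_W T_i = W_i P_W and
    S_i^* J_V = J_V V_i^*. *)
Lemma compress_fixed (U : 'B(HV, HW)) : intertwiners S T U ->
  \sum_i W i \ob (PW \ob U \ob JV) \ob (V i)^† = PW \ob U \ob JV.
Proof.
move=> UST; have [cS cT] := (dilation_rep DV, dilation_rep DW).
apply: bop_ext => k; rewrite bop_sumE /= -[in RHS](cuntz_sum cS (JV k)).
rewrite !linear_sum; apply: eq_bigr => i _.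
rewrite -(dilation_projS DW) -(dilation_badjJ DV).
by have /= <- := congr1 (fun A : 'B(HV, HW) => A ((S i)^† (JV k))) (UST i).
Qed.

(** Two inductions: over H_W to get U J_V = 0, then over H_V. In the first, the quantifier on k
    belongs to the predicate, because moving T_i across the inner product replaces k by V_i^* k. *)
Lemma intertwiner_inj0 (U : 'B(HV, HW)) : intertwiners S T U ->
  PW \ob U \ob JV = 0 -> U = 0.
Proof.
move=> UST U0; have [cS cT] := (dilation_rep DV, dilation_rep DW).
have UJ k : U (JV k) = 0.
  apply: inner_ext => y; rewrite inner0l; move: y k.
  apply: (dilation_ind DW (F := [set y | forall k, '[U (JV k), y] = 0])).
  - rewrite (_ : [set _ | _] = \bigcap_k [set y | '[U (JV k), y] = 0]).
      by apply: closed_bigI => k _; exact: closed_orthogonal.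
    by apply/seteqP; split=> y h k; [move=> _|]; exact: h.
  - by move=> a x y x0 y0 k; rewrite innerDr innerZr x0 y0 mulr0 addr0.
  - move=> k l; rewrite -(dilation_proj_badj DW).
    by have /= -> := congr1 (fun A : 'B(K, K) => A l) U0; rewrite inner0l.
  - move=> i x x0 k; rewrite badjEr (intertwiner_badj cS cT UST).
    by rewrite (dilation_badjJ DV).
apply: bop_ext; apply: (dilation_ind DV (F := [set x | U x = 0])) => //.
- rewrite (_ : [set _ | _] = \bigcap_y [set x | '[U^† y, x] = 0]).
    by apply: closed_bigI => y _; exact: closed_orthogonal.
  apply/seteqP; split=> x /= h.
    by move=> y _; rewrite /= -badjEr h inner0r.
  by apply: inner_ext => y; rewrite inner0l innerC badjEr h // conjC0.
- by move=> a x y /= x0 y0; rewrite /= linearP /= x0 y0 scaler0 addr0.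
- move=> i x /= x0.
  have /= -> := congr1 (fun A : 'B(HV, HW) => A x) (UST i).
  by rewrite /= x0 linear0.
Qed.

Lemma compress_rnorm_le (U : 'B(HV, HW)) : rnorm (PW \ob U \ob JV) <= rnorm U.
Proof.
apply: bop_rnorm_le => [|k]; first exact: rnorm_ge0.
rewrite (le_trans (dilation_rnorm_proj DW _)) //.
rewrite (le_trans (rnorm_bop_le _ _)) //.
by rewrite (dilation_rnorm DV).
Qed.

Lemma push_compress (X : 'B(HV, HW)) n k :
  push T (fun i => (S i)^†) X n (JV k) =
  push T (fun i => (V i)^†) (X \ob JV) n k.
Proof.
elim: n k => [//|n IHn] k; rewrite !pushS; apply: eq_bigr => i _.
by rewrite (dilation_badjJ DV) IHn.
Qed.

Section Lift.
Context (X : 'B(K, K)) (XE : \sum_i W i \ob X \ob (V i)^† = X).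

Let G := push T (fun i => (V i)^†) (JW \ob X).
Let U_ := push T (fun i => (S i)^†) (JW \ob X \ob PV).

Let U_J n k : U_ n (JV k) = G n k.
Proof.
rewrite push_compress; congr (push _ _ _ _ _).
by apply: bop_ext => l /=; rewrite (dilation_projJ DV).
Qed.

(** Here the fixed-point equation enters: by P_W T_i = W_i P_W, each further letter applies A |->
    sum_i W_i A V_i^* to X, which leaves X unchanged. *)
Let proj_G n k : PW (G n k) = X k.
Proof.
elim: n k => [|n IHn] k; first by rewrite /= (dilation_projJ DW).
rewrite /G pushS linear_sum -[in RHS]XE bop_sumE; apply: eq_bigr => i _.
by rewrite /= (dilation_projS DW) IHn.
Qed.

(* The vectors [G n k] form a martingale: their increments are orthogonal to
   the past, so that their squared norms control their distances. *)
Let G_martingale n m k l : (n <= m)%N -> '[G m k, G n l] = '[G n k, G n l].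
Proof.
have cT := dilation_rep DW.
elim: n m k l => [m k l _|n IHn [//|m] k l nm].
  by rewrite /= -!(dilation_proj_badj DW) proj_G (dilation_projJ DW).
rewrite /G !pushS !cuntz_inner_sum //; apply: eq_bigr => i _.
exact: IHn.
Qed.

Let U_le n x : rnorm (U_ n x) <= rnorm X * rnorm x.
Proof.
have [cS cT] := (dilation_rep DV, dilation_rep DW).
apply: (@le_trans _ _ (rnorm (JW \ob X \ob PV) * rnorm x)).
  by apply: rnorm_push_le => // y; exact: sum_rnorm_badj (cS.2) y.
rewrite ler_wpM2r ?rnorm_ge0 //; apply: bop_rnorm_le => [|y].
  exact: rnorm_ge0.
rewrite /= (dilation_rnorm DW) (le_trans (rnorm_bop_le _ _)) //.
by rewrite ler_wpM2l ?rnorm_ge0 // (dilation_rnorm_proj DV).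
Qed.

Let cvg_G k : cvg (G n k @[n --> \oo]).
Proof.
apply: (@cvg_of_sqr_increments _ _ _ (fun n => rnorm (G n k) ^+ 2)
    ((rnorm X * rnorm (JV k)) ^+ 2)).
  by move=> n; rewrite -U_J ler_pXn2r ?nnegrE ?mulr_ge0 ?rnorm_ge0 //.
move=> n m nm; rewrite rnormB_sqr G_martingale // !rnorm_sqr.
by lra.
Qed.

(** The norm bound is half of the isometry. The strong limit is recorded because for X = 1 and a
    single dilation it approximates the identity of H, as the order statement requires. *)
Lemma intertwiner_lift : exists U : 'B(HV, HW),
  [/\ intertwiners S T U, PW \ob U \ob JV = X, rnorm U <= rnorm X &
    forall x,
      push T (fun i => (S i)^†) (JW \ob X \ob PV) n x @[n --> \oo] --> U x].
Proof.
have [cS cT] := (dilation_rep DV, dilation_rep DW).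
have US n i x : U_ n.+1 (S i x) = T i (U_ n x).
  rewrite /U_ pushS (bigD1 i) //= cuntz_badj_gen // eqxx big1 ?addr0 //.
  by move=> j ji; rewrite cuntz_badj_gen // (negbTE ji) !linear0.
have cU x : cvg (U_ n x @[n --> \oo]).
  apply: (dilation_ind DV (F := [set x | cvg (U_ n x @[n --> \oo])])).
  - exact: closed_cvg_bop U_le.
  - move=> a y z /= cy cz; under eq_fun do rewrite linearP.
    by apply: is_cvgD => //; exact: is_cvgZr.
  - by move=> k /=; under eq_fun do rewrite U_J; exact: cvg_G.
  - move=> i y /= /cvg_ex[l yl]; apply/cvg_ex; exists (T i l).
    rewrite -cvg_shiftS; under eq_fun do rewrite US.
    exact: cvg_bop.
have [U UX UP] := strong_limit (rnorm_ge0 X) U_le cU.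
exists U; split=> // [i|].
  apply: bop_ext => x /=.
  have TU : U_ n (S i x) @[n --> \oo] --> T i (U x).
    by rewrite -cvg_shiftS; under eq_fun do rewrite US; exact: cvg_bop.
  exact: (cvg_unique _ (UP (S i x)) TU).
apply: bop_ext => k /=.
have : PW (U_ n (JV k)) @[n --> \oo] --> PW (U (JV k)) by exact: cvg_bop.
under eq_fun do rewrite U_J proj_G.
by move=> /cvg_lim <- //; rewrite lim_cst.
Qed.

End Lift.

End Intertwiners.

(** * Isometry of the correspondence, uniqueness and order *)

Section Correspondence.
Context (R : realType) (d : nat) (K : hilbertType R).

Lemma intertwinersE (H H' : hilbertType R) (S : 'I_d -> 'B(H, H))
    (T : 'I_d -> 'B(H', H')) (U : 'B(H, H')) : intertwiners S T U ->
  forall i x, U (S i x) = T i (U x).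
Proof.
by move=> UST i x; have /= := congr1 (fun A : 'B(H, H') => A x) (UST i).
Qed.

Lemma compress_linear (H H' : hilbertType R) (J : 'B(K, H)) (P : 'B(H', K)) :
  linear (fun A : 'B(H, H') => P \ob A \ob J).
Proof.
by move=> a A B; apply: bop_ext => k; exact: linearP.
Qed.

Lemma intertwiners_correspondence (HV HW : hilbertType R)
    (V W : 'I_d -> 'B(K, K))
    (JV : 'B(K, HV)) (S : 'I_d -> 'B(HV, HV)) (PV : 'B(HV, K))
    (JW : 'B(K, HW)) (T : 'I_d -> 'B(HW, HW)) (PW : 'B(HW, K)) :
  dilation V JV S PV -> dilation W JW T PW ->
  set_bij (intertwiners S T)
    [set X : 'B(K, K) | \sum_(i < d) W i \ob X \ob (V i)^† = X]
    (fun U => PW \ob U \ob JV) /\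
  forall U, intertwiners S T U -> rnorm (PW \ob U \ob JV) = rnorm U.
Proof.
move=> DV DW.
have inj U U' : intertwiners S T U -> intertwiners S T U' ->
    PW \ob U \ob JV = PW \ob U' \ob JV -> U = U'.
  move=> UST UST' UU'; apply/eqP; rewrite -subr_eq0; apply/eqP.
  apply: (intertwiner_inj0 DV DW) => [i|].
    apply: bop_ext => x; rewrite -[LHS]/(U (S i x) - U' (S i x)).
    rewrite -[RHS]/(T i (U x - U' x)) linearB.
    by congr (_ - _); apply: intertwinersE.
  apply: bop_ext => k; rewrite -[LHS]/(PW (U (JV k) - U' (JV k))) linearB /=.
  by have /= -> := congr1 (fun A : 'B(K, K) => A k) UU'; rewrite subrr.
split; first split.
- by move=> U UST; have /= := compress_fixed DV DW UST.
- by move=> U U' /set_mem UST /set_mem UST'; exact: inj.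
- by move=> X XE; have [U [UST UX _ _]] := intertwiner_lift DV DW XE; exists U.
move=> U UST; apply/eqP; rewrite eq_le (compress_rnorm_le DV DW) /=.
(* By injectivity U is the lift of its own compression, so the norm bound on lifts gives the reverse
   inequality. *)
have [U' [UST' UX' leU' _]] :=
  intertwiner_lift DV DW (compress_fixed DV DW UST).
by rewrite -[in leLHS](inj U' U).
Qed.

Lemma badj_intertwiner (H H' : hilbertType R) (S : 'I_d -> 'B(H, H))
    (T : 'I_d -> 'B(H', H')) (U : 'B(H, H')) :
  cuntz_rep S -> cuntz_rep T -> intertwiners S T U -> intertwiners T S U^†.
Proof.
move=> cS cT UST i; apply: bop_ext => y; apply: inner_ext => x /=.
rewrite -badjEr badjE (intertwiner_badj cS cT UST) badjEr.
by rewrite [RHS]badjE.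
Qed.

(** Equality in Cauchy-Schwarz: |U J k| <= |k| by the isometry of the correspondence, while the
    inner product of U J k and J' k is |k|^2; hence |U J k - J' k|^2 <= 0. *)
Lemma dilation_intertwiner_id (H H' : hilbertType R) (V : 'I_d -> 'B(K, K))
    (J : 'B(K, H)) (S : 'I_d -> 'B(H, H)) (P : 'B(H, K))
    (J' : 'B(K, H')) (S' : 'I_d -> 'B(H', H')) (P' : 'B(H', K))
    (U : 'B(H, H')) : dilation V J S P -> dilation V J' S' P' ->
  intertwiners S S' U -> P' \ob U \ob J = bid K -> U \ob J = J'.
Proof.
move=> D D' USS PUJ; apply: bop_ext => k /=.
have Uk l : P' (U (J l)) = l := congr1 (fun A : 'B(K, K) => A l) PUJ.
have leU : rnorm (U (J k)) <= rnorm k.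
  rewrite -[leRHS](dilation_rnorm D) (le_trans (rnorm_bop_le _ _)) //.
  rewrite ler_piMl ?rnorm_ge0 //.
  rewrite -(proj2 (intertwiners_correspondence D D') U USS) PUJ.
  by apply: bop_rnorm_le => // x; rewrite mul1r.
apply/eqP; rewrite -subr_eq0; apply/eqP/rnorm_le0.
rewrite -(@ler_pXn2r _ 2) ?nnegrE ?rnorm_ge0 // expr0n rnormB_sqr.
rewrite -(dilation_proj_badj D') Uk -rnorm_sqr (dilation_rnorm D').
move: leU (rnorm_ge0 (U (J k))); rewrite /=; move: (rnorm _) (rnorm _) => a b.
by nra.
Qed.

(** The lift U of 1 and its adjoint both fix the copies of K. So U^* U and U U^* are
    self-intertwiners with compression 1, like the identities, and compression is injective. *)
Lemma dilation_unique (H H' : hilbertType R) (V : 'I_d -> 'B(K, K))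
    (J : 'B(K, H)) (S : 'I_d -> 'B(H, H)) (P : 'B(H, K))
    (J' : 'B(K, H')) (S' : 'I_d -> 'B(H', H')) (P' : 'B(H', K)) :
  \sum_(i < d) V i \ob (V i)^† = bid K ->
  dilation V J S P -> dilation V J' S' P' -> unitarily_equivalent J S J' S'.
Proof.
move=> hV D D'; have [cS cS'] := (dilation_rep D, dilation_rep D').
have id_fixed : \sum_(i < d) V i \ob bid K \ob (V i)^† = bid K.
  by rewrite -[RHS]hV; apply: eq_bigr => i _; exact: bop_ext.
have [U [USS UE _ _]] := intertwiner_lift D D' id_fixed.
have UJ := dilation_intertwiner_id D D' USS UE.
have USS' := badj_intertwiner cS cS' USS.
have UE' : P \ob U^† \ob J' = bid K.
  apply: bop_ext => k; apply: inner_ext => l /=.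
  rewrite (dilation_proj_badj D) -badjEr -(dilation_embedding D') -UJ.
  by [].
have UJ' := dilation_intertwiner_id D' D USS' UE'.
have comp_id (H1 H2 : hilbertType R) (J1 : 'B(K, H1)) (S1 : 'I_d -> 'B(H1, H1))
    (P1 : 'B(H1, K)) (J2 : 'B(K, H2)) (S2 : 'I_d -> 'B(H2, H2))
    (A : 'B(H1, H2)) (B : 'B(H2, H1)) : dilation V J1 S1 P1 ->
    intertwiners S1 S2 A -> intertwiners S2 S1 B ->
    A \ob J1 = J2 -> B \ob J2 = J1 -> B \ob A = bid H1.
  move=> D1 AS BS AJ BJ.
  have [[_ inj _] _] := intertwiners_correspondence D1 D1.
  apply: inj; rewrite ?inE.
  - move=> i; apply: bop_ext => x /=.
    by rewrite (intertwinersE AS) (intertwinersE BS).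
  - by move=> i; exact: bop_ext.
  apply: bop_ext => k /=.
  have /= -> := congr1 (fun C : 'B(K, H2) => C k) AJ.
  by have /= -> := congr1 (fun C : 'B(K, H1) => C k) BJ.
exists U; split=> //; split; first exact: comp_id D USS USS' UJ UJ'.
exact: comp_id D' USS' USS UJ' UJ.
Qed.

Lemma commutant_intertwiners (H : hilbertType R) (S : 'I_d -> 'B(H, H)) :
  cuntz_rep S -> commutant S = intertwiners S S.
Proof.
move=> cS; apply/seteqP; split=> A h i; first by have [] := h i.
split; first exact: h.
by apply: bop_ext => x; rewrite /= (intertwiner_badj cS cS h).
Qed.

(** In the order of [R[i]] a nonnegative number is real, so the limit argument has to kill the
    imaginary part as well. *)
Lemma complex_ge0_approx (z : R[i]) :
  (forall e : R, 0 < e -> exists2 w : R[i], 0 <= w & `|z - w| <= e%:C) ->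
  0 <= z.
Proof.
move=> h; have hR e : 0 < e -> exists a : R,
    `|complex.Re z - a| <= e /\ 0 <= a /\ `|complex.Im z| <= e.
  move=> e0; have [w w0 zw] := h e e0; exists (complex.Re w).
  have wE : w = (complex.Re w)%:C by rewrite RRe_real // ger0_real.
  split; [|split].
  - rewrite -lecR; apply: (le_trans _ zw); apply: (le_trans _ (normc_ge_Re _)).
    by case: z {h zw} w {wE w0} => a b [c f].
  - by rewrite -ler0c -wE.
  (* Multiplication by ['i] moves the imaginary part, up to sign, to the real part, where the same
     bound applies. *)
  - have zwi : `|(z - w) * 'i| <= e%:C.
      rewrite normrM (_ : `|'i| = 1) ?mulr1 //.
      by rewrite normc_def /= expr0n expr1n add0r sqrtr1.
    rewrite -lecR; apply: (le_trans _ zwi); apply: (le_trans _ (normc_ge_Re _)).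
    rewrite ReiNIm normrN lecR wE.
    by case: z {h wE zw w0 zwi} => a b; rewrite /= oppr0 addr0.
rewrite lecE /=; apply/andP; split.
  rewrite -normr_le0; apply/ler_addgt0Pl => e e0; rewrite addr0.
  by have [a [_ []]] := hR e e0.
apply/ler_addgt0Pl => e e0; have [a [+ [a0 _]]] := hR e e0.
by rewrite ler_norml => /andP[? ?]; lra.
Qed.

Lemma inner_ge0_cvg (H : hilbertType R) (A : 'B(H, H)) (u : nat -> H) x :
  u @ \oo --> x -> (forall n, 0 <= '[A (u n), u n]) -> 0 <= '[A x, x].
Proof.
move=> ux Au; apply: complex_ge0_approx => e e0.
have x1 : 0 < 2 * (rnorm x + 1) by rewrite mulr_gt0 // ltr_wpDl ?rnorm_ge0.
have Ax1 : 0 < 2 * (rnorm (A x) + 1).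
  by rewrite mulr_gt0 // ltr_wpDl ?rnorm_ge0.
have /cvg_rnormP Aux : A (u n) @[n --> \oo] --> A x by exact: cvg_bop.
move/cvg_rnormP: ux => ux.
(* The bound 1 keeps |u n| below |x| + 1; the other one controls the term ['[A x, x - u n]] of the
   decomposition below. *)
have m0 : 0 < Num.min 1 (e / (2 * (rnorm (A x) + 1))).
  by rewrite lt_min ltr01 divr_gt0.
have [N1 _ h1] := ux _ m0; have [N2 _ h2] := Aux _ (divr_gt0 e0 x1).
pose n := maxn N1 N2; exists '[A (u n), u n] => //.
have := h1 n (leq_maxl _ _); have := h2 n (leq_maxr _ _) => /= hA.
rewrite lt_min => /andP[hu1 hu].
have -> : '[A x, x] - '[A (u n), u n] =
    '[A x - A (u n), u n] + '[A x, x - u n].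
  by rewrite innerBl innerBr; ring.
apply: le_trans (ler_normD _ _) _.
apply: le_trans (lerD (normr_inner_le _ _) (normr_inner_le _ _)) _.
rewrite -rmorphD lecR.
rewrite !ltr_pdivlMr // in hA hu.
have un : rnorm (u n) <= rnorm x + 1.
  have -> : u n = x - (x - u n) by rewrite opprB addrC subrK.
  apply: le_trans (rnormD _ _) _.
  by rewrite lerD2l /rnorm normrN -/(rnorm _) ltW.
have := rnorm_ge0 (A x - A (u n)); have := rnorm_ge0 (x - u n).
have := rnorm_ge0 (A x).
nra.
Qed.

(** The hard direction goes from K to H. As C = B - A commutes with the S_i, which have orthogonal
    ranges, '[C (E n x), E n x] is the sum over words of length n of the values of the form of C at
    J P S_w^* x; these are nonnegative, and E n x tends to x. *)
Lemma commutant_op_le (H : hilbertType R) (V : 'I_d -> 'B(K, K))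
    (J : 'B(K, H)) (S : 'I_d -> 'B(H, H)) (P : 'B(H, K)) (A B : 'B(H, H)) :
  \sum_(i < d) V i \ob (V i)^† = bid K -> dilation V J S P ->
  commutant S A -> commutant S B ->
  op_le A B <-> op_le (P \ob A \ob J) (P \ob B \ob J).
Proof.
move=> hV D; have cS := dilation_rep D.
rewrite commutant_intertwiners // => AS BS; pose C : 'B(H, H) := B - A.
have CJ k : '[(P \ob B \ob J - P \ob A \ob J) k, k] = '[C (J k), J k].
  rewrite -(dilation_proj_badj D) -[C _]/(B (J k) - A (J k)) linearB.
  by [].
split=> [h k|h x]; first by rewrite CJ; exact: h.
have id_fixed : \sum_(i < d) V i \ob bid K \ob (V i)^† = bid K.
  by rewrite -[RHS]hV; apply: eq_bigr => i _; exact: bop_ext.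
have [U [US UE _ UP]] := intertwiner_lift D D id_fixed.
(* The identity is also an intertwiner with compression 1; so [UP] says that the approximants tend
   strongly to 1. *)
have UE1 : U = bid H.
  have [[_ inj _] _] := intertwiners_correspondence D D.
  apply: inj; rewrite ?inE //.
    by move=> i; exact: bop_ext.
  by rewrite UE; apply: bop_ext => k /=; rewrite (dilation_projJ D).
have CS i y : C (S i y) = S i (C y).
  rewrite -[LHS]/(B (S i y) - A (S i y)) (intertwinersE AS) (intertwinersE BS).
  by rewrite -linearB.
have CSsum (y : 'I_d -> H) : C (\sum_i S i (y i)) = \sum_i S i (C (y i)).
  by rewrite linear_sum; apply: eq_bigr => i _; exact: CS.
pose E := push S (fun i => (S i)^†) (J \ob bid K \ob P).
have CE n y : 0 <= '[C (E n y), E n y].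
  elim: n y => [|n IHn] y; first by rewrite -CJ; exact: h.
  rewrite /E pushS CSsum.
  by rewrite cuntz_inner_sum // sumr_ge0 // => i _; exact: IHn.
by have := UP x; rewrite UE1 => /inner_ge0_cvg; apply=> n; exact: CE.
Qed.

End Correspondence.

(** * The space of martingales *)

Section ComplexLimits.
Context (R : realType).
Implicit Types (z w : nat -> R[i]) (l m : R[i]).

(** Real and imaginary parts are kept apart because the limits of [wform n f g] arise from monotone
    real sequences by polarization. *)
Definition ccvg z l : Prop :=
  complex.Re (z n) @[n --> \oo] --> complex.Re l /\
  complex.Im (z n) @[n --> \oo] --> complex.Im l.

Lemma ccvg_unique z l m : ccvg z l -> ccvg z m -> l = m.
Proof.
move=> [rl il] [rm im]; have := cvg_unique _ rl rm; have := cvg_unique _ il im.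
by case: l {rl il} => a b; case: m {rm im} => ? ? /= -> // ->.
Qed.

Lemma ccvgP z w l m (a : R[i]) : ccvg z l -> ccvg w m ->
  ccvg (fun n => a * z n + w n) (a * l + m).
Proof.
have reE u v : complex.Re (a * u + v) = complex.Re a * complex.Re u
    - complex.Im a * complex.Im u + complex.Re v.
  by case: a u v => ? ? [? ?] [? ?].
have imE u v : complex.Im (a * u + v) = complex.Re a * complex.Im u
    + complex.Im a * complex.Re u + complex.Im v.
  by case: a {reE} u v => ? ? [? ?] [? ?].
move=> [zl zl'] [wm wm']; split.
  rewrite reE; under eq_fun do rewrite reE.
  by apply: cvgD => //; apply: cvgB; exact: cvgMr.
rewrite imE; under eq_fun do rewrite imE.
by apply: cvgD => //; apply: cvgD; exact: cvgMr.
Qed.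

Lemma ccvg_conj z l : ccvg z l -> ccvg (fun n => Num.conj (z n)) (Num.conj l).
Proof.
have imE u : complex.Im (Num.conj u : R[i]) = - complex.Im u by case: u.
move=> [zl zl']; split.
  by rewrite Re_conj; under eq_fun do rewrite Re_conj.
by rewrite imE; under eq_fun do rewrite imE; exact: cvgN.
Qed.

Lemma ccvg_shift z l : ccvg z l -> ccvg (fun n => z n.+1) l.
Proof.
move=> [zl zl']; split.
  by rewrite (cvg_shiftS (fun n => complex.Re (z n))).
by rewrite (cvg_shiftS (fun n => complex.Im (z n))).
Qed.

Lemma ccvg_cst l : ccvg (fun=> l) l.
Proof. by split; exact: cvg_cst. Qed.

End ComplexLimits.

Section DotNorm.
Context (R : realType) (U : lmodType R[i]) (f : {dot U for @Num.conj R[i]}).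

Definition dot_norm (x : U) : R := Num.sqrt (complex.Re (f x x)).

Lemma dot_normE x : (dot_norm x ^+ 2)%:C = f x x.
Proof.
have f0 := dnorm_ge0 f x.
rewrite /dot_norm sqr_sqrtr ?RRe_real ?ger0_real //.
by rewrite -lecR RRe_real ?ger0_real.
Qed.

Lemma dot_normD x y : dot_norm (x + y) <= dot_norm x + dot_norm y.
Proof.
have n0 z : 0 <= dot_norm z by exact: sqrtr_ge0.
rewrite -(@ler_pXn2r _ 2) ?nnegrE ?addr_ge0 // -lecR dot_normE dnormD.
rewrite -!dot_normE.
have CS : complex.Re (f x y) <= dot_norm x * dot_norm y.
  apply: le_trans (ler_norm _) _; rewrite -lecR.
  apply: le_trans (normc_ge_Re _) _.
  rewrite -(@ler_pXn2r _ 2) ?nnegrE ?normr_ge0 ?ler0c ?mulr_ge0 //.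
  apply: le_trans (cauchy_schwarz f x y) _.
  by rewrite -!dot_normE -rmorphM -rmorphXn exprMn.
have addJ : f x y + Num.conj (f x y) = (2 * complex.Re (f x y))%:C.
  by rewrite rmorphM rmorph_nat -addcJ.
by rewrite addJ -!rmorphD lecR; lra.
Qed.

Lemma dot_normZ (a : R[i]) x : (dot_norm (a *: x))%:C = `|a| * (dot_norm x)%:C.
Proof.
have n0 z : 0 <= dot_norm z by exact: sqrtr_ge0.
apply/eqP; rewrite -(@eqrXn2 _ 2) ?mulr_ge0 ?normr_ge0 ?ler0c //.
have nE z : (dot_norm z)%:C ^+ 2 = f z z by rewrite -dot_normE rmorphXn.
by rewrite exprMn !nE dnormZ.
Qed.

Lemma dot_norm_eq0 x : dot_norm x = 0 -> x = 0.
Proof.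
by move=> x0; apply/eqP; rewrite -(dnorm_eq0 f) -dot_normE x0 expr0n.
Qed.

End DotNorm.

Section Words.
Context (R : realType) (d : nat) (K : hilbertType R).
Context (V : 'I_d -> 'B(K, K)).
Notation wfun := (seq 'I_d -> K).
Implicit Types f g h : wfun.

Definition wshift (i : 'I_d) f : wfun := fun w => f (i :: w).

(* The sum of '[f w, g w] over the words w of length n. *)
Fixpoint wform (n : nat) f g : R[i] :=
  if n is m.+1 then \sum_i wform m (wshift i f) (wshift i g)
  else '[f [::], g [::]].

Definition wnorm2 n f : R := complex.Re (wform n f f).

Lemma wformPl n (a : R[i]) f g h :
  wform n (a *: f + g) h = a * wform n f h + wform n g h.
Proof.
elim: n f g h => [|n IHn] f g h /=; first by rewrite innerDl innerZl.
by rewrite mulr_sumr -big_split; apply: eq_bigr => i _; exact: IHn.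
Qed.

Lemma wformC n f g : wform n f g = Num.conj (wform n g f).
Proof.
elim: n f g => [|n IHn] f g /=; first exact: innerC.
by rewrite rmorph_sum; apply: eq_bigr => i _; exact: IHn.
Qed.

Lemma wformPr n (a : R[i]) f g h :
  wform n f (a *: g + h) = Num.conj a * wform n f g + wform n f h.
Proof.
rewrite wformC wformPl (wformC n f g) (wformC n f h).
by rewrite rmorphD rmorphM.
Qed.

Lemma wform0l n f : wform n 0 f = 0.
Proof.
by have := wformPl n (-1) 0 0 f; rewrite scaler0 addr0 mulN1r addNr.
Qed.

Lemma wform_norm2 n f : wform n f f = (wnorm2 n f)%:C.
Proof.
rewrite /wnorm2; suff : 0 <= wform n f f by move/ger0_real/RRe_real.
elim: n f => [|n IHn] f /=; first exact: dnorm_ge0.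
by apply: sumr_ge0.
Qed.

Lemma wnorm2S n f : wnorm2 n.+1 f = \sum_i wnorm2 n (wshift i f).
Proof.
apply: complexI; rewrite -wform_norm2 /= rmorph_sum.
by apply: eq_bigr => i _; rewrite wform_norm2.
Qed.

Lemma wnorm20 f : wnorm2 0 f = rnorm (f [::]) ^+ 2.
Proof. by rewrite rnorm_sqr. Qed.

Lemma wnorm2_ge0 n f : 0 <= wnorm2 n f.
Proof.
elim: n f => [|n IHn] f; first by rewrite wnorm20 sqr_ge0.
by rewrite wnorm2S sumr_ge0.
Qed.

Lemma wnorm2_word w f : rnorm (f w) ^+ 2 <= wnorm2 (size w) f.
Proof.
elim: w f => [|i w IHw] f; first by rewrite wnorm20.
rewrite wnorm2S (bigD1 i) //=; apply: le_trans (IHw (wshift i f)) _.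
by rewrite lerDl sumr_ge0 // => j _; exact: wnorm2_ge0.
Qed.

Lemma wnorm2D n f g :
  wnorm2 n (f + g) = wnorm2 n f + wnorm2 n g + 2 * complex.Re (wform n f g).
Proof.
rewrite /wnorm2 -[f]scale1r wformPl !wformPr (wformC n g f) !ReD.
rewrite !mul1r rmorph1 !mul1r Re_conj !scale1r; ring.
Qed.

Lemma wnorm2Z n (a : R[i]) f :
  (wnorm2 n (a *: f))%:C = `|a| ^+ 2 * (wnorm2 n f)%:C.
Proof.
rewrite -!wform_norm2 -[a *: f]addr0 wformPl wformPr wform0l.
by rewrite [wform n f 0]wformC wform0l conjC0 !addr0 normCK mulrA.
Qed.

Lemma wnorm2D_le n f g : wnorm2 n (f + g) <= 2 * (wnorm2 n f + wnorm2 n g).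
Proof.
have := wnorm2_ge0 n (f - g).
have -> : f - g = f + (- 1) *: g by rewrite scaleN1r.
rewrite !wnorm2D -[(- 1) *: g]addr0 wformPr [wform n f 0]wformC wform0l.
rewrite conjC0 addr0 rmorphN1 mulN1r addr0.
have -> : wnorm2 n (- 1 *: g) = wnorm2 n g.
  by apply: complexI; rewrite wnorm2Z normrN1 expr1n mul1r.
by case: (wform n f g) => a b /=; lra.
Qed.

(** Pointwise convergence suffices since the words of a fixed length are finite in number. A general
    filter is needed for completeness. *)
Lemma cvg_wnorm2 (T : Type) (F : set_system T) (FF : Filter F) n
    (f : T -> wfun) g : (forall w, f t w @[t --> F] --> g w) ->
  wnorm2 n (f t) @[t --> F] --> wnorm2 n g.
Proof.
elim: n f g => [|n IHn] f g fg.
  rewrite wnorm20; under eq_fun do rewrite wnorm20.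
  have : rnorm (f t [::]) @[t --> F] --> rnorm (g [::]).
    apply/cvgrPdist_lt => e e0; have /cvg_rnormP/(_ e e0) := fg [::].
    apply: filterS => t; apply: le_lt_trans.
    have := rnormD (f t [::] - g [::]) (g [::]).
    have := rnormD (g [::] - f t [::]) (f t [::]).
    rewrite !subrK (rnormBC (f t [::])) ler_norml; lra.
  by move=> h; rewrite !expr2; under eq_fun do rewrite expr2; exact: cvgM.
rewrite wnorm2S; under eq_fun do rewrite wnorm2S.
apply: cvg_big => [|i _]; first exact: add_continuous.
by apply: IHn => w; exact: fg.
Qed.

Definition martingale f : Prop := forall w, f w = \sum_i V i (f (rcons w i)).

Lemma martingale_shift i f : martingale f -> martingale (wshift i f).
Proof. by move=> mf w; exact: mf (i :: w). Qed.

Context (hV : \sum_i V i \ob (V i)^† = bid K).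

(** The row of the V_i is a coisometry: with y its value at x, the sum of the |x_i - V_i^* y|^2
    equals the sum of the |x_i|^2 minus |y|^2. *)
Lemma rnorm_row_le (x : 'I_d -> K) :
  rnorm (\sum_i V i (x i)) ^+ 2 <= \sum_i rnorm (x i) ^+ 2.
Proof.
set y := \sum_i _.
have : 0 <= \sum_i rnorm (x i - (V i)^† y) ^+ 2.
  by apply: sumr_ge0 => i _; exact: sqr_ge0.
under eq_bigr do rewrite rnormB_sqr.
rewrite big_split sumrB /= sum_rnorm_badj // -mulr_sumr.
have -> : \sum_i complex.Re '[x i, (V i)^† y] = rnorm y ^+ 2.
  rewrite rnorm_sqr {2}/y inner_suml (big_morph _ (@ReD R) (erefl _)).
  by apply: eq_bigr => i _; rewrite badjE.
lra.
Qed.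

Lemma wnorm2_le_succ n f : martingale f -> wnorm2 n f <= wnorm2 n.+1 f.
Proof.
elim: n f => [|n IHn] f mf; rewrite wnorm2S.
  rewrite wnorm20 (mf [::]); under [leRHS]eq_bigr do rewrite wnorm20.
  exact: rnorm_row_le.
rewrite wnorm2S; apply: ler_sum => i _; apply: IHn.
exact: martingale_shift.
Qed.

End Words.

Section MartingaleSpace.
Context (R : realType) (d : nat) (K : hilbertType R).
Context (V : 'I_d -> 'B(K, K)).
Notation wfun := (seq 'I_d -> K).

Definition bounded_martingale : {pred wfun} := fun f =>
  `[< martingale V f /\ exists M : R, forall n, wnorm2 n f <= M >].

Fact bounded_martingale_submod_closed : submod_closed bounded_martingale.
Proof.
split=> [|a f g].
  rewrite inE; split=> [w|]; first by rewrite big1 // => i _; exact: linear0.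
  exists 0 => n; suff -> : wnorm2 n (0 : wfun) = 0 by [].
  by rewrite /wnorm2 wform0l.
rewrite !inE => -[mf [M fM]] [mg [N gN]]; split=> [w|].
  rewrite -[LHS]/(a *: f w + g w) mf mg scaler_sumr -big_split.
  by apply: eq_bigr => i _ /=; rewrite -linearP.
exists (2 * (complex.Re (`|a| ^+ 2) * M + N)) => n.
apply: le_trans (wnorm2D_le _ _ _) _.
rewrite ler_pM2l // lerD //.
have aE : (complex.Re (`|a| ^+ 2))%:C = `|a| ^+ 2.
  by rewrite RRe_real // ger0_real // exprn_ge0.
have -> : wnorm2 n (a *: f) = complex.Re (`|a| ^+ 2) * wnorm2 n f.
  by apply: complexI; rewrite wnorm2Z -aE rmorphM.
by rewrite ler_wpM2l // -ler0c aE exprn_ge0.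
Qed.

HB.instance Definition _ := GRing.isSubmodClosed.Build R[i] wfun
  bounded_martingale bounded_martingale_submod_closed.

End MartingaleSpace.

Section MartingaleType.
Context (R : realType) (d : nat) (K : hilbertType R).
Context (V : 'I_d -> 'B(K, K)).
Context (hV : \sum_i V i \ob (V i)^† = bid K).
Notation wfun := (seq 'I_d -> K).

(* The proof [h] is a phantom parameter: it lets the Hilbert space structure
   below use that the norms [wnorm2 n f] increase with n. *)
Record mspace (h : \sum_i V i \ob (V i)^† = bid K) := MSpace {
  mfun :> wfun;
  mfunP : mfun \in bounded_martingale V
}.

Notation M := (mspace hV).

HB.instance Definition _ := [isSub for @mfun hV].
HB.instance Definition _ := [Choice of M by <:].
HB.instance Definition _ := [SubChoice_isSubLmodule of M by <:].

Implicit Types f g : M.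

Lemma mspace_martingale f : martingale V f.
Proof. by have := mfunP f; rewrite inE => -[]. Qed.

Lemma mspace_ext f g : (forall w, f w = g w) -> f = g.
Proof. by move=> fg; apply: val_inj; apply/funext. Qed.

Definition mnorm2 f : R := lim (wnorm2 n f @[n --> \oo]).

Lemma wnorm2_homo f n m : (n <= m)%N -> wnorm2 n f <= wnorm2 m f.
Proof.
move/subnK <-; elim: (m - n)%N => [//|k IHk]; apply: le_trans IHk _.
by rewrite addSn; apply: wnorm2_le_succ hV _ _ _; exact: mspace_martingale.
Qed.

Lemma cvg_mnorm2 f : wnorm2 n f @[n --> \oo] --> mnorm2 f.
Proof.
apply: nondecreasing_is_cvgn => [n m|]; first exact: wnorm2_homo.
have := mfunP f; rewrite inE => -[_ [M fM]].
by exists M => _ [n _ <-].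
Qed.

Lemma wnorm2_le_mnorm2 n f : wnorm2 n f <= mnorm2 f.
Proof.
apply: nondecreasing_cvgn_le => [k m|]; first exact: wnorm2_homo.
exact: cvg_mnorm2.
Qed.

(** Polarization, since monotonicity provides limits of [wnorm2] only. As the form is antilinear on
    the right, its imaginary part at g is its real part at ['i *: g]. *)
Definition mform f g : R[i] :=
  ((mnorm2 (f + g) - mnorm2 f - mnorm2 g) / 2) +i*
  ((mnorm2 (f + 'i *: g) - mnorm2 f - mnorm2 ('i *: g)) / 2).

Lemma mformE f g : ccvg (fun n => wform n f g) (mform f g).
Proof.
have cRe (h : M) : complex.Re (wform n f h) @[n --> \oo] -->
    (mnorm2 (f + h) - mnorm2 f - mnorm2 h) / 2.
  have -> : (fun n => complex.Re (wform n f h)) =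
      (fun n => (wnorm2 n (f + h) - wnorm2 n f - wnorm2 n h) / 2).
    by apply/funext => n; rewrite wnorm2D; field.
  apply: cvgMl; apply: cvgB; last exact: cvg_mnorm2.
  by apply: cvgB; [exact: (@cvg_mnorm2 (f + h)) | exact: cvg_mnorm2].
split; first exact: cRe.
have -> : (fun n => complex.Im (wform n f g)) =
    (fun n => complex.Re (wform n f ('i *: g))).
  apply/funext => n.
  have -> : wform n f ('i *: g) = Num.conj 'i * wform n f g.
    have -> : mfun ('i *: g) = 'i *: (g : wfun) + 0 by rewrite addr0.
    by rewrite wformPr [wform n f 0]wformC wform0l conjC0 addr0.
  by case: (wform n f g) => a b /=; rewrite mul0r sub0r mulN1r opprK.
exact: cRe.
Qed.

Lemma mform_norm2 f : mform f f = (mnorm2 f)%:C.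
Proof.
apply: ccvg_unique (mformE f f) _.
under [X in ccvg X]eq_fun do rewrite wform_norm2.
by split; [exact: cvg_mnorm2 | exact: cvg_cst].
Qed.

Fact mform_bilinear : bilinear_for (GRing.Scale.Law.clone _ _ *%R _)
  (GRing.Scale.Law.clone _ _ (@Num.conj R[i] \; *%R) _) mform.
Proof.
split=> h a f g.
  apply: ccvg_unique (mformE _ _) _.
  under [X in ccvg X]eq_fun do rewrite wformPl.
  by apply: ccvgP; exact: mformE.
apply: ccvg_unique (mformE _ _) _.
under [X in ccvg X]eq_fun do rewrite wformPr.
by apply: ccvgP; exact: mformE.
Qed.

HB.instance Definition _ :=
  bilinear_isBilinear.Build R[i] M M R[i] _ _ mform mform_bilinear.

Fact mform_hermitian f g : mform f g = (-1) ^+ false * Num.conj (mform g f).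
Proof.
rewrite mul1r; apply: ccvg_unique (mformE f g) _.
under [X in ccvg X]eq_fun do rewrite wformC.
exact/ccvg_conj/mformE.
Qed.

HB.instance Definition _ :=
  isHermitianSesquilinear.Build R[i] M false (@Num.conj R[i]) mform
    mform_hermitian.

Fact mform_gt0 f : f != 0 -> 0 < mform f f.
Proof.
move=> f0; rewrite mform_norm2 ltcR lt_def.
have m0 : 0 <= mnorm2 f.
  by apply: le_trans (wnorm2_le_mnorm2 0 f); exact: wnorm2_ge0.
rewrite m0 andbT; apply: contra f0 => /eqP f0; apply/eqP/mspace_ext => w.
apply: rnorm_le0; rewrite -(@ler_pXn2r _ 2) ?nnegrE ?rnorm_ge0 //.
apply: le_trans (wnorm2_word w f) _.
by apply: le_trans (wnorm2_le_mnorm2 _ _) _; rewrite f0 expr0n.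
Qed.

HB.instance Definition _ := isDotProduct.Build R[i] M mform mform_gt0.

Definition mdot : {dot M for @Num.conj R[i]} := mform.

Let mnorm f : R[i] := (dot_norm mdot f)%:C.

Let mnormD f g : mnorm (f + g) <= mnorm f + mnorm g.
Proof. by rewrite -rmorphD lecR dot_normD. Qed.

Let mnormZ a f : mnorm (a *: f) = `|a| * mnorm f.
Proof. exact: dot_normZ. Qed.

Let mnorm_eq0 f : mnorm f = 0 -> f = 0.
Proof. by move=> /complexI/dot_norm_eq0. Qed.

HB.instance Definition _ := Lmodule_isNormed.Build R[i] M
  mnormD mnormZ mnorm_eq0.

Lemma mspace_rnorm_sqr f : rnorm f ^+ 2 = mnorm2 f.
Proof.
by apply: complexI; rewrite -mform_norm2 -(dot_normE mdot).
Qed.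

Lemma cauchy_pointwise_cvg (F : set_system M) (FF : ProperFilter F) :
  cauchy F -> exists g : wfun, forall w, (f : M) w @[f --> F] --> g w.
Proof.
move=> cF.
suff h w : exists k : K, (f : M) w @[f --> F] --> k.
  by exists (fun w => projT1 (cid (h w))) => w; exact: (projT2 (cid (h w))).
apply/cvg_ex; apply: cauchy_cvg; apply: cauchy_exP.
move=> _ /gt0_complexE[e e0 ->].
have e0C : 0 < e%:C by rewrite ltcR.
have /cauchyP/(_ _ e0C)[f0 Ff0] := cF; exists (f0 w).
suff sub (f : M) : ball f0 e%:C f -> ball (f0 w) e%:C (f w).
  by apply: (filterS sub Ff0).
rewrite -!ball_normE /= -!rnormE !ltcR.
apply: le_lt_trans.
rewrite -(@ler_pXn2r _ 2) ?nnegrE ?rnorm_ge0 // mspace_rnorm_sqr.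
exact: le_trans (wnorm2_word w (f0 - f)) (wnorm2_le_mnorm2 _ _).
Qed.

(** As for l^2: the pointwise limit g is compared with elements of the filter at each fixed length,
    and only then is the length sent to infinity. *)
Fact mspace_complete (F : set_system M) : ProperFilter F -> cauchy F -> cvg F.
Proof.
move=> FF cF; have [g gF] := cauchy_pointwise_cvg FF cF.
have near_g (f0 : M) (e : R) : 0 < e -> F (ball f0 e%:C) ->
    forall n, wnorm2 n ((f0 : wfun) - g) <= e ^+ 2.
  move=> e0 Ff0 n.
  have cv : wnorm2 n ((f0 : wfun) - (f : M)) @[f --> F] -->
      wnorm2 n ((f0 : wfun) - g).
    apply: cvg_wnorm2 => w; apply: cvgB; first exact: cvg_cst.
    exact: gF.
  apply: (cvgr_to_le cv); apply: filterS Ff0 => f.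
  rewrite -ball_normE /= -rnormE ltcR => f0f.
  apply: le_trans (wnorm2_le_mnorm2 n (f0 - f)) _.
  by rewrite -mspace_rnorm_sqr ler_pXn2r ?nnegrE ?rnorm_ge0 ?ltW.
have mg : martingale V g.
  move=> w; have h : (f : M) w @[f --> F] --> \sum_i V i (g (rcons w i)).
    under eq_cvg do rewrite mspace_martingale.
    apply: cvg_big => [|i _]; first exact: add_continuous.
    by apply: cvg_bop; exact: gF.
  exact: cvg_unique _ (gF w) h.
have gb : g \in bounded_martingale V.
  have e1 : 0 < (1 : R)%:C by rewrite ltcR.
  have /cauchyP/(_ _ e1)[f0 Ff0] := cF.
  have f0g : ((f0 : wfun) - g) \in bounded_martingale V.
    rewrite inE; split=> [w|].
      rewrite -[LHS]/(f0 w - g w) mspace_martingale mg -sumrB.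
      by apply: eq_bigr => i _; rewrite -linearB.
    by exists (1 ^+ 2) => n; exact: near_g.
  rewrite (_ : g = (- 1) *: ((f0 : wfun) - g) + (f0 : wfun)).
    by apply: (bounded_martingale_submod_closed V).2 => //; exact: mfunP.
  by rewrite scaleN1r opprB subrK.
have [h hg] : exists h : M, mfun h = g by exists (MSpace hV gb).
apply/cvg_ex; exists h.
apply/fcvgrPdist_lt => _ /gt0_complexE[e e0 ->].
have e3 : 0 < e / 3 by lra.
have e3C : 0 < (e / 3)%:C by rewrite ltcR.
have /cauchyP/(_ _ e3C)[f0 Ff0] := cF.
have f0g : rnorm (f0 - h) <= e / 3.
  have e30 : 0 <= e / 3 by exact: ltW.
  rewrite -(@ler_pXn2r _ 2) ?nnegrE ?rnorm_ge0 // mspace_rnorm_sqr.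
  have cv := @cvg_mnorm2 (f0 - h).
  apply: (cvgr_to_le cv).
  apply: nearW => n; rewrite -[mfun _]/(mfun f0 - mfun h) hg.
  exact: near_g.
suff sub (f : M) : ball f0 (e / 3)%:C f -> `|h - f| < e%:C.
  exact: (filterS sub Ff0).
rewrite -ball_normE => f0f_ball.
have f0f : rnorm (f0 - f) < e / 3 by rewrite -ltcR rnormE; exact: f0f_ball.
rewrite -rnormE ltcR.
have le_h : rnorm (h - f) <= rnorm (h - f0) + rnorm (f0 - f).
  by rewrite -[in leLHS](subrK f0 h) -addrA rnormD.
rewrite rnormBC in f0g.
apply: le_lt_trans le_h _; apply: le_lt_trans (lerD f0g (ltW f0f)) _.
by lra.
Qed.

HB.instance Definition _ := Uniform_isComplete.Build M mspace_complete.

Fact mspace_inner_norm f : `|f| ^+ 2 = mdot f f.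
Proof. by rewrite -(dot_normE mdot) -rnormE rmorphXn. Qed.

HB.instance Definition _ := isHilbert.Build R M mspace_inner_norm.


End MartingaleType.

(** * Existence of the dilation *)

Section MartingaleOperators.
Context (R : realType) (d : nat) (K : hilbertType R).
Context (V : 'I_d -> 'B(K, K)).
Context (hV : \sum_i V i \ob (V i)^† = bid K).
Notation wfun := (seq 'I_d -> K).
Notation M := (mspace hV : hilbertType R).

Lemma mspace_inner_ccvg (f g : M) : ccvg (fun n => wform n f g) '[f, g].
Proof. exact: mformE. Qed.

Lemma mspace_op (L : hilbertType R) (F : L -> wfun) :
  (forall (a : R[i]) x y, F (a *: x + y) = a *: F x + F y) ->
  (forall x, martingale V (F x)) ->
  (forall n x, wnorm2 n (F x) <= rnorm x ^+ 2) ->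
  exists A : 'B(L, M), forall x, mfun (A x) = F x.
Proof.
move=> FP mF Fle.
have /choice[G GF] : forall x, exists h : M, mfun h = F x.
  move=> x; suff Fx : F x \in bounded_martingale V by exists (MSpace hV Fx).
  by rewrite inE; split=> //; exists (rnorm x ^+ 2).
have [||A AG] := @bop_of_linear _ _ _ G 1.
- move=> a x y; apply: mspace_ext => w.
  rewrite GF FP -[RHS]/(a *: mfun (G x) w + mfun (G y) w).
  by rewrite !GF.
- move=> x; rewrite mul1r -(@ler_pXn2r _ 2) ?nnegrE ?rnorm_ge0 //.
  rewrite mspace_rnorm_sqr; have cv := @cvg_mnorm2 _ _ _ _ hV (G x).
  by apply: (cvgr_to_le cv); apply: nearW => n; rewrite GF.
by exists A => x; rewrite AG.
Qed.

(** The value at the empty word is forced: the martingale condition there has a single term that can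
    be nonzero, for the letter i. *)
Definition wprepend (i : 'I_d) (f : wfun) : wfun := fun w =>
  if w is j :: w' then if j == i then f w' else 0 else V i (f [::]).

(** The martingale of J k, sending w to P S_w^* J k; the first letter acts first because S_(iw)^* =
    S_w^* S_i^*. *)
Definition wconst (k : K) : wfun := foldl (fun l i => (V i)^† l) k.

Lemma row_sum k : \sum_i V i ((V i)^† k) = k.
Proof.
by have := congr1 (fun A : 'B(K, K) => A k) hV; rewrite bop_sumE.
Qed.

Lemma wshift_prepend i j f :
  wshift i (wprepend j f) = if i == j then f else 0.
Proof. by apply/funext => w; rewrite /wshift /=; case: eqP. Qed.

Lemma wform_prepend n i f g :
  wform n.+1 (wprepend i f) g = wform n f (wshift i g).
Proof.
rewrite /= (bigD1 i) //= wshift_prepend eqxx big1 ?addr0 // => j ji.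
by rewrite wshift_prepend (negbTE ji) wform0l.
Qed.

(** Moving each V_i^* to the left argument leaves an iterated martingale identity. This makes
    evaluation at the empty word the adjoint of J. *)
Lemma wform_const n f k : martingale V f ->
  wform n f (wconst k) = '[f [::], k].
Proof.
elim: n f k => [//|n IHn] f k mf.
rewrite (mf [::]) inner_suml; apply: eq_bigr => i _.
by rewrite badjE; apply: (IHn (wshift i f)); exact: martingale_shift.
Qed.

Lemma martingale_prepend i f : martingale V f -> martingale V (wprepend i f).
Proof.
move=> mf [|j w] /=.
  rewrite (bigD1 i) //= eqxx big1 ?addr0 // => j ji.
  by rewrite (negbTE ji) linear0.
by case: eqP => _; [exact: mf | rewrite big1 // => k _; rewrite linear0].
Qed.

Lemma martingale_const k : martingale V (wconst k).
Proof.
move=> w; rewrite -[LHS]row_sum; apply: eq_bigr => i _.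
by rewrite /wconst foldl_rcons.
Qed.

Lemma shift_op i : exists A : 'B(M, M), forall f, mfun (A f) = wshift i f.
Proof.
apply: mspace_op => // [f|n f].
  by apply: martingale_shift; exact: mspace_martingale.
rewrite mspace_rnorm_sqr; apply: le_trans (wnorm2_le_mnorm2 n.+1 f).
by rewrite wnorm2S (bigD1 i) //= lerDl sumr_ge0 // => j _; exact: wnorm2_ge0.
Qed.

Lemma prepend_op i : exists A : 'B(M, M), forall f, mfun (A f) = wprepend i f.
Proof.
apply: mspace_op => [a f g|f|n f].
- apply/funext => -[|j w].
    exact: linearP.
  rewrite -[RHS]/(a *: wprepend i f (j :: w) + wprepend i g (j :: w)) /=.
  by case: eqP => // _; rewrite scaler0 addr0.
- by apply: martingale_prepend; exact: mspace_martingale.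
- have mf : martingale V (wprepend i f).
    by apply: martingale_prepend; exact: mspace_martingale.
  (* [wform_prepend] computes at positive lengths only, so monotonicity first raises n to n + 1. *)
  apply: le_trans (wnorm2_le_succ hV _ mf) _.
  rewrite /wnorm2 wform_prepend wshift_prepend eqxx -/(wnorm2 _ _).
  by rewrite mspace_rnorm_sqr wnorm2_le_mnorm2.
Qed.

Lemma const_op : exists A : 'B(K, M), forall k, mfun (A k) = wconst k.
Proof.
apply: mspace_op => [a k l|k|n k].
- apply/funext => w.
  rewrite -[RHS]/(a *: wconst k w + wconst l w) /wconst.
  by elim: w k l => [//|i w IHw] k l /=; rewrite linearP IHw.
- exact: martingale_const.
- by rewrite /wnorm2 wform_const ?rnorm_sqr //; exact: martingale_const.
Qed.

Lemma head_op : exists A : 'B(M, K), forall f : M, A f = f [::].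
Proof.
have [//||A AE] := @bop_of_linear _ M _ (fun f : M => f [::]) 1; last first.
  by exists A.
move=> f; rewrite mul1r -(@ler_pXn2r _ 2) ?nnegrE ?rnorm_ge0 //.
rewrite mspace_rnorm_sqr -wnorm20; exact: wnorm2_le_mnorm2.
Qed.

End MartingaleOperators.

Section LinearSpan.
Context (R : realType) (H : hilbertType R).
Implicit Types X : set H.

Lemma lin_span_incl X x : X x -> lin_span X x.
Proof.
move=> Xx; exists 1%N, (fun=> 1), (fun=> x); split=> //.
by rewrite big_ord1 scale1r.
Qed.

Lemma lin_span0 X : lin_span X 0.
Proof.
exists 0%N, (fun=> 0), (fun=> 0); split; first by case.
by rewrite big_ord0.
Qed.

Lemma lin_spanD X x y : lin_span X x -> lin_span X y -> lin_span X (x + y).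
Proof.
move=> [n [c [v [Xv ->]]]] [m [e [w [Xw ->]]]].
exists (n + m)%N,
  (fun k => match fintype.split k with inl i => c i | inr j => e j end),
  (fun k => match fintype.split k with inl i => v i | inr j => w j end); split.
  by move=> k; case: (fintype.split k).
rewrite big_split_ord /=; congr (_ + _); apply: eq_bigr => i _.
  by rewrite (unsplitK (inl i : 'I_n + 'I_m)).
by rewrite (unsplitK (inr i : 'I_n + 'I_m)).
Qed.

Lemma lin_span_bop X (A : 'B(H, H)) x : (forall y, X y -> X (A y)) ->
  lin_span X x -> lin_span X (A x).
Proof.
move=> XA [n [c [v [Xv ->]]]]; exists n, c, (A \o v); split=> [k|].
  exact: XA.
by rewrite linear_sum; apply: eq_bigr => k _; rewrite linearZ.
Qed.

End LinearSpan.

Section Existence.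
Context (R : realType) (d : nat).
Implicit Types H K : hilbertType R.

Lemma cyclic_of_push K H (J : 'B(K, H)) (P : 'B(H, K)) (S : 'I_d -> 'B(H, H)) :
  cuntz_rep S ->
  (forall x, push S (fun i => (S i)^†) (J \ob P) n x @[n --> \oo] --> x) ->
  cyclic_for S J.
Proof.
move=> cS Ex.
pose X : set H := [set A (J k) | A in cstar_generated S & k in setT].
suff : dense (lin_span X) by [].
apply/dense_rnormP => x e e0.
have XJ k : X (J k).
  exists (bid H); last by exists k.
  (* [cstar_subalgebra] does not demand a unit; the identity is generated as sum_i S_i S_i^*. *)
  move=> N [cN SN]; rewrite -cS.2; apply: (big_ind N); first exact: cstar0 cN.
    by move=> A B NA NB; have := cstarP cN 1 NA NB; rewrite scale1r.
  move=> i _; apply: (cstarM cN); first by apply: SN; exists i.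
  by apply: (cstar_adj cN); apply: SN; exists i.
have XS i y : X y -> X (S i y).
  move=> [A GA [k _ <-]]; exists (S i \ob A); last by exists k.
  move=> N [cN SN]; apply: (cstarM cN); first by apply: SN; exists i.
  exact: GA.
have spanE n y : lin_span X (push S (fun i => (S i)^†) (J \ob P) n y).
  elim: n y => [|n IHn] y; first by apply: lin_span_incl; exact: XJ.
  rewrite pushS; apply: (big_ind (lin_span X)).
  - exact: lin_span0.
  - exact: lin_spanD.
  - by move=> i _; apply: lin_span_bop; [exact: XS | exact: IHn].
have /cvg_rnormP/(_ _ e0)[N _ hN] := Ex x.
exists (push S (fun i => (S i)^†) (J \ob P) N x); first exact: spanE.
exact: hN (leqnn N).
Qed.

Lemma dilation_exists K (V : 'I_d -> 'B(K, K)) :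
  \sum_i V i \ob (V i)^† = bid K ->
  exists (H : hilbertType R) (J : 'B(K, H)) (S : 'I_d -> 'B(H, H))
    (P : 'B(H, K)), dilation V J S P.
Proof.
move=> hV; pose M : hilbertType R := mspace hV.
have [shift_ shiftE] : exists A : 'I_d -> 'B(M, M),
    forall i f, mfun (A i f) = wshift i f.
  have [A AE] := choice (shift_op hV); by exists A.
have [S SE] : exists A : 'I_d -> 'B(M, M),
    forall i f, mfun (A i f) = wprepend V i f.
  have [A AE] := choice (prepend_op hV); by exists A.
have [J JE] := const_op hV; have [P PE] := head_op hV.
have Sadj i : (S i)^† = shift_ i.
  apply: badj_uniq => f g.
  (* Prepending a letter raises the length by one, so level n + 1 of this form matches level n of
     the form with the shifted g. *)
  apply: ccvg_unique (ccvg_shift (mspace_inner_ccvg (S i f) g)) _.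
  under [X in ccvg X]eq_fun do rewrite SE wform_prepend -shiftE.
  exact: mspace_inner_ccvg.
have PJ f k : '[f, J k] = '[P f, k].
  apply: ccvg_unique (mspace_inner_ccvg f (J k)) _.
  under [X in ccvg X]eq_fun do
    rewrite JE (wform_const _ _ (@mspace_martingale _ _ _ _ hV f)) -PE.
  exact: ccvg_cst.
have PJK k : P (J k) = k by rewrite PE JE.
have cS : cuntz_rep S.
  split=> [i j|]; apply: bop_ext => f; apply: mspace_ext => w.
    rewrite Sadj -[LHS]/(mfun (shift_ i (S j f)) w) shiftE SE wshift_prepend.
    by case: (i == j).
  have sum_mfun (F : 'I_d -> M) v : mfun (\sum_i F i) v = \sum_i F i v.
    by elim/big_ind2: _ => // a x b y <- <-.
  rewrite bop_sumE sum_mfun; under eq_bigr do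
    rewrite -[mfun _ _]/(mfun (S _ ((S _)^† f)) w) SE Sadj.
  (* At the empty word this is the martingale identity for f; at j :: w only the summand j
     survives. *)
  case: w => [|j w].
    rewrite [RHS](mspace_martingale f [::]); apply: eq_bigr => i _.
    by rewrite /= shiftE.
  rewrite (bigD1 j) //= eqxx shiftE big1 ?addr0 // => i ij.
  by rewrite eq_sym (negbTE ij).
have sadj i f : (S i)^† f = shift_ i f by rewrite Sadj.
exists M, J, S, P; split.
- by move=> k l; have := PJ (J k) l; rewrite PJK.
- exact: cS.
- by move=> f k; rewrite innerBl !PJ PJK subrr.
- move=> i k; exists ((V i)^† k) => //; rewrite Sadj; apply: mspace_ext => w.
  by rewrite shiftE !JE.
- move=> i; apply: bop_ext => k.
  by rewrite -[LHS]/(P ((S i)^† (J k))) Sadj PE shiftE JE.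
- apply: (cyclic_of_push (P := P)) => // f; apply/cvg_rnormP => e e0.
  (* [E n f] is a projection of f: its squared norm and its inner product with f are both
     [wnorm2 n f], so the squared distance to f is [mnorm2 f - wnorm2 n f]. *)
  pose E := push S (fun i => (S i)^†) (J \ob P).
  have fE n g : '[g, E n g] = (wnorm2 n g)%:C.
    elim: n g => [|n IHn] g.
      by rewrite -[E 0%N g]/(J (P g)) PJ PE -wform_norm2.
    rewrite /E pushS inner_sumr wnorm2S rmorph_sum; apply: eq_bigr => i _.
    by rewrite badjEr [LHS]IHn Sadj shiftE.
  have EE n g : '[E n g, E n g] = (wnorm2 n g)%:C.
    elim: n g => [|n IHn] g.
      by rewrite -[E 0%N g]/(J (P g)) PJ PJK PE -wform_norm2.
    rewrite /E pushS cuntz_inner_sum // wnorm2S rmorph_sum.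
    by apply: eq_bigr => i _; rewrite [LHS]IHn Sadj shiftE.
  have dist n : rnorm (f - E n f) ^+ 2 = mnorm2 f - wnorm2 n f.
    rewrite rnormB_sqr (rnorm_sqr (E n f)) EE fE mspace_rnorm_sqr /=; ring.
  have /cvgrPdist_lt/(_ (e ^+ 2)) := @cvg_mnorm2 _ _ _ _ hV f.
  have e2 : 0 < e ^+ 2 by rewrite exprn_gt0.
  move=> /(_ e2); apply: filterS => n; rewrite -dist ger0_norm ?sqr_ge0 //.
  by rewrite ltr_pXn2r ?nnegrE ?rnorm_ge0 ?(ltW e0).
Qed.

End Existence.

Theorem theorem5p1 (R : realType) (d : nat) (hd : (2 <= d)%N)
    (K : hilbertType R) (V : 'I_d -> 'B(K, K))
    (hV : \sum_(i < d) V i \ob (V i)^† = bid K) :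
  [/\ (* existence of the dilation *)
      exists (H : hilbertType R) (J : 'B(K, H)) (S : 'I_d -> 'B(H, H))
        (P : 'B(H, K)), dilation V J S P,
      (* uniqueness up to unitary equivalence *)
      forall (H : hilbertType R) (J : 'B(K, H)) (S : 'I_d -> 'B(H, H))
        (P : 'B(H, K)) (H' : hilbertType R) (J' : 'B(K, H'))
        (S' : 'I_d -> 'B(H', H')) (P' : 'B(H', K)),
        dilation V J S P -> dilation V J' S' P' ->
        unitarily_equivalent J S J' S',
      (* commutant and fixed points of sigma *)
      forall (H : hilbertType R) (J : 'B(K, H)) (S : 'I_d -> 'B(H, H))
        (P : 'B(H, K)), dilation V J S P ->
        let Phi := fun A' : 'B(H, H) => P \ob A' \ob J in
        [/\ linear Phi,
            set_bij (commutant S) [set A | sigma V A = A] Phi,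
            forall A', commutant S A' -> `|Phi A'| = `|A'| &
            forall A' B', commutant S A' -> commutant S B' ->
              op_le A' B' <-> op_le (Phi A') (Phi B')] &
      (* intertwiners *)
      forall (W : 'I_d -> 'B(K, K)),
        \sum_(i < d) W i \ob (W i)^† = bid K ->
      forall (HV : hilbertType R) (JV : 'B(K, HV)) (S : 'I_d -> 'B(HV, HV))
        (PV : 'B(HV, K)) (HW : hilbertType R) (JW : 'B(K, HW))
        (T : 'I_d -> 'B(HW, HW)) (PW : 'B(HW, K)),
        dilation V JV S PV -> dilation W JW T PW ->
        let Psi := fun U : 'B(HV, HW) => PW \ob U \ob JV in
        [/\ linear Psi,
            set_bij (intertwiners S T)
              [set X : 'B(K, K) |
                \sum_(i < d) W i \ob X \ob (V i)^† = X] Psi &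
            forall U, intertwiners S T U -> `|Psi U| = `|U|]].
Proof.
have normE (H H' : hilbertType R) (A : 'B(H, H')) : `|A| = (rnorm A)%:C.
  by rewrite rnormE.
split.
- exact: dilation_exists.
- by move=> H J S P H' J' S' P'; exact: dilation_unique.
- move=> H J S P D Phi.
  have [bij iso] := intertwiners_correspondence D D.
  have cE := commutant_intertwiners (dilation_rep D).
  split.
  + exact: compress_linear.
  + by rewrite cE.
  + by move=> A; rewrite cE => AS; rewrite !normE iso.
  + by move=> A B; exact: commutant_op_le hV D.
- move=> W hW HV JV S PV HW JW T PW DV DW Psi.
  have [bij iso] := intertwiners_correspondence DV DW.
  split=> //; first exact: compress_linear.
  by move=> U US; rewrite !normE iso.
Qed.
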